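(* Let $1\le k_1<\cdots<k_r\le n$ be integers, put $\mathbf{k}=(k_1,\dots,k_r)$, $k_0=0$, $k_{r+1}=n$, and let $X$ be an $n\times n$ symmetric matrix of unknowns. For a generic choice of $\mathbf{c}=(c_1,\ldots,c_n)$ satisfying $c_{k_j+1}=\cdots=c_{k_{j+1}}$ for $j=0,\ldots,r$, the isospectral model $\mathrm{Fl}_{\mathbf{c}}(\mathbf{k};n)$ is smooth and its vanishing ideal is the prime ideal $$I(\mathrm{Fl}_{\mathbf{c}}(\mathbf{k};n))=\Big\langle \prod_{c}(X-c\,\mathrm{Id}_n),\ \ \operatorname{trace}(X)-\sum_{j=1}^n c_j\Big\rangle\subset\mathbb{C}[X],$$ where the product runs over the distinct values $c$ among $c_1,\dots,c_n$ (that is, over $c_{k_1},\ldots,c_{k_r},c_{k_{r+1}}$ if $k_r<n$, and over $c_{k_1},\ldots,c_{k_r}$ if $k_r=n$).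
   Context: Let $X_0=\mathrm{diag}(c_1,\ldots,c_n)$. The isospectral model $\mathrm{Fl}_{\mathbf{c}}(\mathbf{k};n)$ is the image of the map $\mathrm{SO}(n)\to\mathbb{C}^{n\times n}$, $Q\mapsto QX_0Q^T$, where $\mathrm{SO}(n)=\{Q\in\mathbb{C}^{n\times n}:Q^TQ=\mathrm{Id}_n,\ \det Q=1\}$; it is viewed as a subvariety of the space of complex symmetric $n\times n$ matrices. $\mathbb{C}[X]$ is the polynomial ring in the $\binom{n+1}{2}$ independent entries of $X$, and a matrix listed as an ideal generator stands for all of its entries. ''Generic'' means: for all $\mathbf{c}$ outside a proper Zariski closed subset of the linear space of vectors in $\mathbb{C}^n$ satisfying the stated equalities. *)

(* Defs.v *)
From HB Require Import structures.
From mathcomp Require Import all_boot all_order all_algebra.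
From mathcomp Require Import ring_quotient.
From mathcomp Require Import boolp classical_sets reals.
From mathcomp Require Import complex mpoly.

Set Implicit Arguments.
Unset Strict Implicit.
Unset Printing Implicit Defensive.

Import GRing.Theory.
Local Open Scope ring_scope.
Local Open Scope classical_set_scope.

(** * Affine algebraic geometry in K^N, points being row vectors *)

Section AffineGeometry.
Variables (K : fieldType) (N : nat).
Implicit Types (Y : set 'rV[K]_N) (p v : 'rV[K]_N) (f : {mpoly K[N]}).

Definition peval f p : K := f.@[p 0].

Definition zero_locus (S : set {mpoly K[N]}) : set 'rV[K]_N :=
  [set p | forall f, S f -> peval f p = 0].

Definition zariski_closed Y : Prop := exists S, Y = zero_locus S.

Definition irreducible_set Y : Prop :=
  Y !=set0 /\
  forall A B, zariski_closed A -> zariski_closed B ->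
    Y `<=` A `|` B -> Y `<=` A \/ Y `<=` B.

Definition vanishing_ideal Y : set {mpoly K[N]} :=
  [set f | forall p, Y p -> peval f p = 0].

(* The classes of g_0, ..., g_(d-1) in the coordinate ring K[x] / I(Y) are
   algebraically independent over K. *)
Definition alg_independent_on Y (d : nat) (g : d.-tuple {mpoly K[N]}) : Prop :=
  forall P : {mpoly K[d]}, vanishing_ideal Y (P \mPo g) -> P = 0.

(* Dimension of an irreducible closed set: the transcendence degree over K of
   its coordinate ring (equivalently, of its function field). *)
Definition has_dimension Y (d : nat) : Prop :=
  (exists g : d.-tuple {mpoly K[N]}, alg_independent_on Y g) /\
  (forall m (g : m.-tuple {mpoly K[N]}), alg_independent_on Y g -> (m <= d)%N).

(* Zariski tangent space, defined by the differentials at p of all the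
   polynomials of the vanishing ideal. *)
Definition tangent_space Y p : set 'rV[K]_N :=
  [set v | forall f, vanishing_ideal Y f ->
             \sum_(i < N) peval f^`M(i) p * v 0 i = 0].

Definition subspace_has_dim (V : set 'rV[K]_N) (d : nat) : Prop :=
  exists B : 'M[K]_(d, N), row_free B /\ V = [set v | (v <= B)%MS].

Definition smooth_variety Y : Prop :=
  [/\ zariski_closed Y, irreducible_set Y
    & exists2 d, has_dimension Y d
               & forall p, Y p -> subspace_has_dim (tangent_space Y p) d].

End AffineGeometry.

Section Ideals.
Variable A : comNzRingType.

Definition generated_ideal (G : set A) : set A :=
  [set f | exists m (a g : 'I_m -> A),
             (forall i, G (g i)) /\ f = \sum_(i < m) a i * g i].

(* [idealr_closed] includes properness. *)
Definition prime_ideal (I : set A) : Prop :=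
  idealr_closed (mem I) /\ prime_idealr_closed (mem I).

Definition entries m n (M : 'M[A]_(m, n)) : set A :=
  [set f | exists i j, f = M i j].

End Ideals.

(** * Symmetric matrices as an affine space *)

(* Positions on or above the diagonal index the independent entries of a
   symmetric matrix. *)
Definition on_or_above n : pred ('I_n * 'I_n) := fun ij => (ij.1 <= ij.2)%N.

Definition upos (n : nat) := {ij : 'I_n * 'I_n | on_or_above ij}.

Definition sdim (n : nat) : nat := #|{: upos n}|.

Lemma upos_subproof n (i j : 'I_n) :
  on_or_above (if (i <= j)%N then (i, j) else (j, i)).
Proof. by rewrite /on_or_above; case: (leqP i j) => [|/ltnW]. Qed.

Definition upos_of n (i j : 'I_n) : upos n :=
  exist (@on_or_above n) _ (upos_subproof i j).

Definition sym_coord (K : fieldType) n (M : 'M[K]_n) : 'rV[K]_(sdim n) :=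
  \row_(k < sdim n) M (val (enum_val k)).1 (val (enum_val k)).2.

Definition sym_var (K : fieldType) n : 'M[{mpoly K[sdim n]}]_n :=
  \matrix_(i, j) 'X_(enum_rank (upos_of i j)).

(* The number of variables, and the generic symmetric matrix
   evaluates at the coordinates of a symmetric matrix M to M itself. *)
Lemma sdimE n : sdim n = 'C(n.+1, 2).
Proof.
rewrite /sdim card_sig -sum1_card.
rewrite -(pair_big_dep predT (fun i j : 'I_n => (i <= j)%N) (fun _ _ => 1%N)) /=.
rewrite (exchange_big_dep predT) //= -(bin2_sum n.+1) big_mkord big_ord_recl add0n.
apply: eq_bigr => j _.
rewrite -(big_ord_widen n (fun=> 1%N) (ltn_ord j)) sum1_card card_ord.
by rewrite lift0.
Qed.

Lemma sym_varK (K : fieldType) n (M : 'M[K]_n) : M^T = M ->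
  map_mx (fun f => peval f (sym_coord M)) (sym_var K n) = M.
Proof.
move=> Msym; apply/matrixP => i j; rewrite !mxE /peval mevalXU mxE enum_rankK /=.
by case: leqP => // _; rewrite -[in LHS]Msym mxE.
Qed.

(** * Isospectral models *)

Section Isospectral.
Variable K : fieldType.

Definition special_orthogonal n : set 'M[K]_n :=
  [set Q | Q^T *m Q = 1%:M /\ \det Q = 1].
Arguments special_orthogonal : clear implicits.

Definition isospectral_model n (c : 'rV[K]_n) : set 'M[K]_n :=
  [set Q *m diag_mx c *m Q^T | Q in special_orthogonal n].

Definition isospectral_variety n (c : 'rV[K]_n) : set 'rV[K]_(sdim n) :=
  [set sym_coord M | M in isospectral_model c].

(* The vectors c with c_(k_j + 1) = ... = c_(k_(j+1)) for j = 0, ..., r, where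
   k_0 = 0 and k_(r+1) = n.  Entries of c are numbered from 0 here, so this
   block consists of the indices a with k_j <= a < k_(j+1). *)
Definition block_space r (k : r.-tuple nat) n : set 'rV[K]_n :=
  let kk := nth 0%N (0%N :: rcons k n) in
  [set c | forall (j : 'I_r.+1) (a b : 'I_n),
             (kk j <= a < kk j.+1)%N -> (kk j <= b < kk j.+1)%N ->
             c 0 a = c 0 b].

Definition distinct_values n (c : 'rV[K]_n) : seq K := undup (codom (c 0)).

(* The factors commute, so their order is irrelevant. *)
Definition min_poly_mx n (c : 'rV[K]_n) : 'M[{mpoly K[sdim n]}]_n :=
  \prod_(x <- distinct_values c) (sym_var K n - (x%:MP)%:M).

Definition isospectral_ideal n (c : 'rV[K]_n) : set {mpoly K[sdim n]} :=
  generated_ideal (entries (min_poly_mx c) `|`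
                   [set \tr (sym_var K n) - (\sum_(j < n) c 0 j)%:MP]).

End Isospectral.
Arguments block_space K [r] k n.

(* Main.v *)
Require Import Defs.
From HB Require Import structures.
From mathcomp Require Import all_boot all_order all_algebra.
From mathcomp Require Import generic_quotient ring_quotient.
From mathcomp Require Import boolp classical_sets reals.
From mathcomp Require Import fingroup perm complex mpoly ring.
Set Implicit Arguments.
Unset Strict Implicit.
Unset Printing Implicit Defensive.
Import GRing.Theory Num.Theory.
Local Open Scope ring_scope.
Local Open Scope classical_set_scope.

(** Why the theorem holds.  Let X_0 = diag(c), with distinct eigenvalues x_t.

    Flags.  To an invertible frame M attach the flag spanned by its blocks of
    columns, and to the flag the symmetric matrix Phi(M) (flag_point) that acts
    as x_t on the orthogonal complement of each step in the next one.  Phi is a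
    rational map with denominator a product of Gram determinants (flag_denom).
    These determinants are 1 on an orthogonal Q, and Phi(Q) = Q X_0 Q^T; a
    symmetric matrix killed by the product of the X - x_t has an orthogonal
    eigenbasis, so if the trace determines the multiplicities then Phi takes
    values in the model Y and is onto (isospectral_modelP).  The same argument
    shows that Y is the zero set of the proposed ideal I.  As f vanishes on Y
    exactly when the polynomial obtained from f(Phi(M)) by clearing the
    denominator is zero, the vanishing ideal is prime (vanishing_ideal_prime).

    Generators.  Phi has sections already over the algebra A = K[X]/I: for any
    matrix Q the frame U whose columns in block t are the projections of those
    of Q to the x_t-eigenspace (eigenframe) satisfies X U = U X_0, hence
    Phi(U) = X up to denominators.  So when f vanishes on Y, a power of the
    denominator at U kills f in A (denom_annihilates).  The denominators for
    all Q have no common zero in any field that receives A, because there X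
    again has an orthogonal eigenbasis (denom_nonvanishing).  Hence the
    annihilator of f in A is contained in no maximal ideal, and f is 0 in A
    (vanishing_idealE).

    Smoothness.  Differentiating the generators at Q X_0 Q^T with divided
    differences identifies the tangent space with the symmetric matrices W, in
    the basis Q, that vanish on the diagonal blocks (tangent_spaceE); let d be
    its dimension.  The d off-block entries of X are algebraically independent
    on Y: a relation could be differentiated along the velocities of rotations
    until it became a nonzero constant (off_block_entries_independent).  More
    than d functions are dependent: a generic flag is spanned by a block
    unitriangular frame, so Y has a dense rational parametrization by d
    variables, and d + 1 rational functions of d variables are dependent by
    comparing dimensions of spaces of polynomials (independent_size).

    Genericity.  The trace determines the multiplicities unless one of finitely
    many differences of sums of the c_a vanishes; each is a nonzero linear form
    on the block space (generic_trace_separated). *)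

(** * Ideals of commutative rings given as sets *)

Section SetIdeals.
Variable A : comNzRingType.
Implicit Types (I J : set A) (a : A).

Lemma idealr_closedP I : idealr_closed (mem I) <->
  [/\ I 0, ~ I 1 & forall a u v, I u -> I v -> I (a * u + v)].
Proof.
split=> [[I0 I1 ID]|[I0 I1 ID]].
  split; first by rewrite -in_setE.
    by move/mem_set => h; rewrite h in I1.
  move=> a u v /mem_set uI /mem_set vI; apply: set_mem; exact: ID.
split; first exact: mem_set.
  by apply/negP => /set_mem.
move=> a u v /set_mem uI /set_mem vI; apply: mem_set; exact: ID.
Qed.

Lemma quotient_morphism I : idealr_closed (mem I) ->
  exists (B : comNzRingType) (p : {rmorphism A -> B}),
    (forall a, p a = 0 <-> I a) /\ (forall b, exists a, p a = b).
Proof.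
move=> Iid; pose S : A -> bool := fun a => a \in I.
have Sid : idealr_closed S.
  by case: Iid => I0 I1 ID; split => // a u v uS vS; exact: ID.
pose HS := @isIdealr.Build A S Sid.
pose Sz : idealr A := HB.pack S HS.
pose p (a : A) : {ideal_quot Sz} := (\pi_({ideal_quot Sz}) a)%qT.
have pM : monoid_morphism p by split=> [|x y]; rewrite /p; rewrite !piE.
have pD : zmod_morphism p by move=> x y; rewrite /p !piE.
pose pDm := GRing.isZmodMorphism.Build _ _ p pD.
pose pMm := GRing.isMonoidMorphism.Build _ _ p pM.
pose pr : {rmorphism A -> {ideal_quot Sz}} := HB.pack p pDm pMm.
exists {ideal_quot Sz}, pr; split=> [a|b]; last first.
  by exists (generic_quotient.repr b); rewrite /= /p reprK.
rewrite /= /p; have -> : (0 : {ideal_quot Sz}) = (\pi_({ideal_quot Sz}) 0)%qT.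
  by rewrite piE.
split.
  by move/eqP; rewrite piE Quotient.equivE subr0 => /set_mem.
by move=> Ia; apply/eqP; rewrite piE Quotient.equivE subr0; apply/mem_set.
Qed.

(** A quotient by a maximal ideal, which Zorn's lemma provides, is a field. *)
Lemma morphism_to_field J : idealr_closed (mem J) ->
  exists (F : fieldType) (p : {rmorphism A -> F}), forall a, J a -> p a = 0.
Proof.
move=> /idealr_closedP [J0 J1 JD].
pose ideal_over (X : set A) := idealr_closed (mem (J `|` X)).
have [F FJ Ftot|X [/idealr_closedP Xid Xmax]] := @Zorn_bigcup A ideal_over.
  apply/idealr_closedP; split; first by left.
    case=> // -[X FX X1].
    by have /idealr_closedP [_ + _] := FJ _ FX; apply; right.
  have inX X a u v : F X -> (J `|` X) u -> (J `|` X) v ->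
      (J `|` \bigcup_(X in F) X) (a * u + v).
    move=> FX uX vX; have /idealr_closedP [_ _ /(_ a _ _ uX vX)] := FJ _ FX.
    by case=> ?; [left|right; exists X].
  move=> a u v [uJ|[X FX uX]] [vJ|[Z FZ vZ]].
  - by left; exact: JD.
  - by apply: (inX Z) => //; [left|right].
  - by apply: (inX X) => //; [right|left].
  - case: (Ftot _ _ FX FZ) => sub; [apply: (inX Z)|apply: (inX X)] => //;
      by right=> //; exact: sub.
case: Xid => X0 X1 XD.
have XM a u : (J `|` X) u -> (J `|` X) (a * u).
  by move=> uX; rewrite -[_ * _]addr0; apply: XD.
have [B [p [pker psurj]]] := @quotient_morphism (J `|` X)
  (iffRL (idealr_closedP _) (And3 X0 X1 XD)).
have inv_ex (b : B) : b != 0 -> exists b', b' * b = 1.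
  move=> b0; have [a pa] := psurj b.
  pose Z : set A := [set z | exists u w, (J `|` X) w /\ z = u * a + w].
  have XZ : (J `|` X) `<=` Z by move=> w wX; exists 0, w; rewrite mul0r add0r.
  have aZ : Z a by exists 1, 0; rewrite mul1r addr0.
  have ZE : J `|` Z = Z by apply/seteqP; split=> z; [case=> // ?; apply: XZ; left|right].
  have [] := pselect (Z 1) => [[u [w [wX e]]]|Z1].
    by exists (p u); rewrite -pa -rmorphM -(rmorph1 p) e rmorphD (iffRL (pker w)) ?addr0.
  (* Otherwise the ideal Z generated by X and a would be proper and larger. *)
  exfalso; apply: (Xmax Z); last first.
    rewrite /ideal_over ZE; apply/idealr_closedP; split=> //; first exact: XZ.
    move=> c _ _ [u1 [w1 [w1X ->]]] [u2 [w2 [w2X ->]]].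
    exists (c * u1 + u2), (c * w1 + w2); split; first exact: XD.
    by rewrite mulrDr mulrA addrACA -mulrDl.
  split=> [w wX|]; first by apply: XZ; right.
  move=> /(_ a aZ) aX; move/eqP: b0; apply; rewrite -pa; apply/pker; by right.
pose inv (b : B) : B :=
  if pselect (b != 0) is left b0 then projT1 (cid (inv_ex b b0)) else 0.
have mulVb b : b != 0 -> inv b * b = 1.
  by move=> b0; rewrite /inv; case: pselect => // b0'; case: cid.
have inv0 : inv 0 = 0 by rewrite /inv; case: pselect => // h; case/eqP: (h).
pose fB := GRing.ComNzRing_isField.Build B mulVb inv0.
pose F : fieldType := HB.pack (GRing.ComNzRing.sort B) fB.
exists F, p => a Ja; by apply/pker; left.
Qed.

Lemma generated_ideal_closed (G : set A) : ~ generated_ideal G 1 ->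
  idealr_closed (mem (generated_ideal G)).
Proof.
move=> G1; apply/idealr_closedP; split=> //.
  by exists 0%N, (fun=> 0), (fun=> 0); split=> [[]//|]; rewrite big_ord0.
move=> c _ _ [m1 [a1 [g1 [G1g ->]]]] [m2 [a2 [g2 [G2g ->]]]].
exists (m1 + m2)%N,
  (fun i => match split i with inl j => c * a1 j | inr j => a2 j end),
  (fun i => match split i with inl j => g1 j | inr j => g2 j end).
split=> [i|]; first by case: split.
rewrite big_split_ord /= mulr_sumr; congr (_ + _); apply: eq_bigr => i _.
  by case: split_ordP => j => [/lshift_inj <-|/eqP]; rewrite ?mulrA ?eq_lrshift.
by case: split_ordP => j => [/eqP|/rshift_inj <-]; rewrite ?mulrA ?eq_rlshift.
Qed.

Lemma generated_ideal_gen (G : set A) g : G g -> generated_ideal G g.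
Proof.
move=> Gg; exists 1%N, (fun=> 1), (fun=> g); split=> //.
by rewrite big_ord1 mul1r.
Qed.

End SetIdeals.

(** * Polynomials in several variables *)

Lemma mpoly_ring_ind (K : comNzRingType) N (P : {mpoly K[N]} -> Prop) :
  (forall c, P c%:MP) -> (forall i, P 'X_i) ->
  (forall f g, P f -> P g -> P (f + g)) ->
  (forall f g, P f -> P g -> P (f * g)) -> forall f, P f.
Proof.
move=> PC PX PD PM f; rewrite [f]mpolyE; elim/big_ind: _ => //.
  by rewrite -mpolyC0.
move=> m _; rewrite -mul_mpolyC; apply: (PM) => //.
rewrite mpolyXE_id; elim/big_ind: _ => [||i _] //; first by rewrite -mpolyC1.
elim: (m i) => [|k IH]; first by rewrite expr0 -mpolyC1.
by rewrite exprS; apply: PM.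
Qed.

Lemma mmap_rmorphism (K K' B : comNzRingType) N (i : {rmorphism K -> K'})
    (phi : {rmorphism K' -> B}) (psi : {rmorphism K -> B}) (y : 'I_N -> K') f :
  (forall c, phi (i c) = psi c) ->
  phi (mmap i y f) = mmap psi (phi \o y) f.
Proof.
move=> phiE; rewrite /mmap rmorph_sum; apply: eq_bigr => m _.
rewrite rmorphM phiE; congr (_ * _).
by rewrite /mmap1 rmorph_prod; apply: eq_bigr => j _; rewrite rmorphXn.
Qed.

Section NaturalPoints.
Variable K : idomainType.
Hypothesis K_char0 : forall k, k.+1%:R != 0 :> K.

Lemma natr_inj_char0 : injective (fun k => k%:R : K).
Proof.
suff le_inj k l : (k <= l)%N -> k%:R = l%:R :> K -> k = l.
  by move=> k l e; case: (leqP k l) => [|/ltnW] h; [|apply/esym]; apply: le_inj.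
move=> /subnKC <-; case: (l - k)%N => [|j]; first by rewrite addn0.
by rewrite natrD => /eqP; rewrite -subr_eq0 opprD addNKr oppr_eq0 (negPf (K_char0 _)).
Qed.

Lemma poly_nat_nonroot (p : {poly K}) : p != 0 -> exists k, p.[k%:R] != 0.
Proof.
move=> p0; apply: contrapT => /forallNP noroot.
have := max_poly_roots (rs := [seq k%:R | k <- iota 0 (size p)]) p0.
rewrite size_map size_iota ltnn => rootsF; suff: false by []; apply: rootsF; last first.
  by rewrite map_inj_uniq ?iota_uniq //; exact: natr_inj_char0.
by apply/allP => _ /mapP [k _ ->]; apply/rootP; have /negP/negPn/eqP := noroot k.
Qed.

Let widen n (i : 'I_n) := widen_ord (leqnSn n) i.

Lemma muni_horner n (f : {mpoly K[n.+1]}) (v : 'I_n.+1 -> K) :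
  (map_poly (meval (v \o @widen n)) (muni f)).[v ord_max] = f.@[v].
Proof.
rewrite muniE rmorph_sum horner_sum mevalE; apply: eq_bigr => m _ /=.
rewrite map_polyZ /= map_polyXn hornerZ hornerXn mevalZ mevalX -mulrA.
by rewrite big_ord_recr /=; congr (_ * (_ * _)); apply: eq_bigr => i _; rewrite mnmE.
Qed.

Lemma muni_eq0 n (f : {mpoly K[n.+1]}) : muni f = 0 -> f = 0.
Proof.
move=> f0; apply/mpolyP => m; rewrite mcoeff0.
have : ((muni f)`_(m ord_max))@_[multinom m (widen i) | i < n] = 0.
  by rewrite f0 coef0 mcoeff0.
rewrite muniE coef_sum raddf_sum /=.
have [msf|] := boolP (m \in msupp f); last by rewrite mcoeff_msupp negbK => /eqP.
rewrite (bigD1_seq m) ?msupp_uniq //= coefZ coefXn eqxx mulr1 mcoeffZ mcoeffX.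
rewrite eqxx mulr1 big1 ?addr0 // => m' m'm.
rewrite coefZ coefXn; have [e|_] := eqVneq; last by rewrite mulr0 mcoeff0.
rewrite mulr1 mcoeffZ mcoeffX; have [e'|_] := eqVneq; last by rewrite mulr0.
case/eqP: m'm; apply/mnmP => i; have [j ->|->] := unliftP ord_max i; last by rewrite e.
have -> : lift ord_max j = widen j by apply/val_inj => /=; rewrite /bump leqNgt ltn_ord.
by have /mnmP /(_ j) := e'; rewrite !mnmE.
Qed.

(** Evaluation at integral points, not just at all points of K, is what makes
    the conclusion usable over a field extension. *)
Lemma mpoly_nat_eq0 n (f : {mpoly K[n]}) :
  (forall v : 'I_n -> nat, f.@[fun i => (v i)%:R] = 0) -> f = 0.
Proof.
elim: n f => [|n IH] f f0.
  by have := f0 (fun=> 0%N); rewrite (nvar0_mpolyC f) mevalC => ->; rewrite mpolyC0.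
apply: muni_eq0; apply/polyP => k; rewrite coef0; apply: IH => w.
pose p := map_poly (meval (fun i => (w i)%:R : K)) (muni f).
suff p0 : p = 0 by rewrite -coef_map -/p p0 coef0.
apply/eqP; apply: contraT => /poly_nat_nonroot [t] /eqP; case.
pose v (i : 'I_n.+1) : nat := if unlift ord_max i is Some j then w j else t.
rewrite -[RHS](f0 v) -muni_horner /v unlift_none; congr (_.[_]).
apply: eq_map_poly => g; apply: meval_eq => j /=.
have -> : widen j = lift ord_max j by apply/val_inj => /=; rewrite /bump leqNgt ltn_ord.
by rewrite liftK.
Qed.

End NaturalPoints.

Section HomogenizedEvaluation.
Variables (K : comNzRingType) (N : nat).
Implicit Types (f : {mpoly K[N]}) (k : nat).

(** [homog_eval k i f u y] is u^k f(y / u) with the denominators cleared; it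
    makes sense in rings where u has no inverse. *)
Definition homog_eval k (B : comNzRingType) (i : {rmorphism K -> B}) f
    (u : B) (y : 'I_N -> B) : B :=
  \sum_(m : 'X_{1..N < k.+1}) i f@_m * (u ^+ (k - mdeg m) * mmap1 y m).

Lemma homog_evalE k (B : comNzRingType) (i : {rmorphism K -> B}) f u (y z : 'I_N -> B) :
  (msize f <= k.+1)%N -> (forall j, y j = u * z j) ->
  homog_eval k i f u y = u ^+ k * mmap i z f.
Proof.
move=> fk yz; rewrite (mmapE k.+1) // mulr_sumr; apply: eq_bigr => m _.
rewrite [RHS]mulrCA; congr (_ * _).
have -> : mmap1 y m = u ^+ mdeg m * mmap1 z m.
  rewrite /mmap1 mdegE expr_sum -big_split; apply: eq_bigr => j _ /=.
  by rewrite yz exprMn.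
rewrite mulrA -exprD subnK //; by have := bmdeg m; rewrite ltnS.
Qed.

Lemma homog_eval_rmorphism k (B B' : comNzRingType) (i : {rmorphism K -> B})
    (i' : {rmorphism K -> B'}) (phi : {rmorphism B -> B'}) f u y u' y' :
  (forall c, phi (i c) = i' c) -> phi u = u' -> (forall j, phi (y j) = y' j) ->
  phi (homog_eval k i f u y) = homog_eval k i' f u' y'.
Proof.
move=> phii <- phiy; rewrite rmorph_sum; apply: eq_bigr => m _.
rewrite !rmorphM phii rmorphXn; congr (_ * (_ * _)).
by rewrite /mmap1 rmorph_prod; apply: eq_bigr => j _; rewrite rmorphXn phiy.
Qed.

End HomogenizedEvaluation.

Section DirectionalDerivative.
Variables (K : comNzRingType) (N : nat).
Implicit Types (f : {mpoly K[N]}) (p v : 'I_N -> K).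

Definition on_line p v f : {poly K} :=
  mmap polyC (fun i => (p i)%:P + v i *: 'X) f.

HB.instance Definition _ p v := GRing.RMorphism.copy (on_line p v)
  (mmap polyC (fun i => (p i)%:P + v i *: 'X)).

Lemma on_line0 p v f : (on_line p v f)`_0 = f.@[p].
Proof.
elim/mpoly_ring_ind: f => [c|i|f g IHf IHg|f g IHf IHg].
- by rewrite /on_line mmapC coefC mevalC.
- by rewrite /on_line mmapX mmap1U coefD coefC coefZ coefX mulr0 addr0 mevalXU.
- by rewrite rmorphD coefD IHf IHg mevalD.
- by rewrite rmorphM coef0M IHf IHg mevalM.
Qed.

Lemma on_line1 p v f : (on_line p v f)`_1 = \sum_i f^`M(i).@[p] * v i.
Proof.
elim/mpoly_ring_ind: f => [c|i|f g IHf IHg|f g IHf IHg].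
- rewrite /on_line mmapC coefC big1 // => i _.
  by rewrite mderivC meval0 mul0r.
- rewrite /on_line mmapX mmap1U coefD coefC coefZ coefX mulr1 add0r.
  rewrite (bigD1 i) //= mderivX mnm1E eqxx scale1r.
  have -> : (U_(i) - U_(i))%MM = 0%MM by apply/mnmP => j; rewrite mnmBE mnm0E subnn.
  rewrite mpolyX0 meval1 mul1r big1 ?addr0 // => j ji.
  by rewrite mderivX mnm1E eq_sym (negPf ji) scale0r meval0 mul0r.
- rewrite rmorphD coefD IHf IHg -big_split; apply: eq_bigr => i _ /=.
  by rewrite mderivD mevalD mulrDl.
- rewrite rmorphM coefM big_ord_recl big_ord1 /= subn0 /bump /= subnn IHf IHg !on_line0.
  rewrite mulr_sumr mulr_suml -big_split; apply: eq_bigr => i _ /=.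
  by rewrite mderivM mevalD !mevalM mulrDl addrC mulrA mulrAC.
Qed.

End DirectionalDerivative.

(** * Algebraic dependence of rational functions *)

Lemma card_bmultinom_le d w : (#|{: 'X_{1..d < w}}| <= w ^ d)%N.
Proof.
have lt_mw (m : 'X_{1..d < w}) i : (m i < w)%N.
  by apply: leq_ltn_trans (bmdeg m); rewrite mdegE (bigD1 i) //= leq_addr.
case: w lt_mw => [|w] lt_mw.
  by rewrite eq_card0 // => m; have := bmdeg m; rewrite ltn0.
pose h (m : 'X_{1..d < w.+1}) : {ffun 'I_d -> 'I_w.+1} := [ffun i => inord (m i)].
have h_inj : injective h.
  move=> m m' e; apply/val_inj/mnmP => i.
  have /(congr1 val) : h m i = h m' i by rewrite e.
  by rewrite !ffunE /= !inordK.
by have := leq_card h h_inj; rewrite card_ffun !card_ord.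
Qed.

Lemma card_bmultinom_ge m q : (q ^ m <= #|{: 'X_{1..m < (m * q).+1}}|)%N.
Proof.
pose mn (a : {ffun 'I_m -> 'I_q}) : 'X_{1..m} := [multinom (a i : nat) | i < m].
have mn_lt a : (mdeg (mn a) < (m * q).+1)%N.
  rewrite ltnS mdegE -[m in (m * q)%N]card_ord -sum_nat_const.
  by apply: leq_sum => i _; rewrite mnmE ltnW.
pose h a := BMultinom (mn_lt a).
have h_inj : injective h.
  move=> a b /(congr1 val) /= /mnmP e; apply/ffunP => i; apply/val_inj.
  by have := e i; rewrite !mnmE.
by have := leq_card h h_inj; rewrite card_ffun !card_ord.
Qed.

Lemma expn_growth d m D : (d < m)%N ->
  exists q, ((D * (m * q)).+1 ^ d < q ^ m)%N.
Proof.
move=> dm; exists ((D * m).+1 ^ d).+1.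
set q := ((D * m).+1 ^ d).+1.
have q0 : (0 < q)%N by [].
apply: (@leq_ltn_trans (((D * m).+1 * q) ^ d)).
  have [->|d0] := posnP d; first by rewrite !expn0.
  by rewrite leq_exp2r // mulSn mulnA -add1n leq_add2r.
apply: (@leq_trans (q ^ d.+1)); last exact: leq_pexp2l.
by rewrite expnMn expnS ltn_mul2r expn_gt0 q0 /= /q ltnS.
Qed.

Section DegreeBounds.
Variables (K : idomainType) (N : nat).
Implicit Types f g : {mpoly K[N]}.

Lemma msizeM_leS a b f g : (msize f <= a.+1)%N -> (msize g <= b.+1)%N ->
  (msize (f * g) <= (a + b).+1)%N.
Proof.
have [->|f0] := eqVneq f 0; first by rewrite mul0r msize0.
have [->|g0] := eqVneq g 0; first by rewrite mulr0 msize0.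
move=> fa gb; rewrite msizeM //.
by have := leq_add fa gb; rewrite addSn addnS; case: (_ + _)%N.
Qed.

Lemma msizeX_leS a f e : (msize f <= a.+1)%N -> (msize (f ^+ e) <= (a * e).+1)%N.
Proof.
move=> fa; elim: e => [|e IH]; first by rewrite expr0 msize1.
by rewrite exprS mulnS; apply: msizeM_leS.
Qed.

Lemma msize_mmap1_leS n a (G : 'I_n -> {mpoly K[N]}) m :
  (forall i, msize (G i) <= a.+1)%N -> (msize (mmap1 G m) <= (a * mdeg m).+1)%N.
Proof.
move=> Ga; rewrite /mmap1 mdegE big_distrr /=.
elim/big_rec2: _ => [|i e g _ IH]; first by rewrite msize1.
by apply: msizeM_leS => //; apply: msizeX_leS.
Qed.

End DegreeBounds.

(** The polynomials of degree at most mq in m variables form a space of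
    dimension at least q^m, while those of degree at most D m q in d variables
    form a space of dimension at most (D m q + 1)^d, which is smaller for large
    q when d < m; so the substitution y = G / H has a kernel. *)
Lemma rational_algebraic_dependence (K : fieldType) d m
    (H : {mpoly K[d]}) (G : 'I_m -> {mpoly K[d]}) : (d < m)%N ->
  exists (P : {mpoly K[m]}) (k : nat),
    [/\ P != 0, (msize P <= k.+1)%N & homog_eval k (@mpolyC d K) P H G = 0].
Proof.
move=> dm.
pose D := maxn (msize H) (\max_i msize (G i)).
have HD : (msize H <= D.+1)%N by apply: leqW; apply: leq_maxl.
have GD i : (msize (G i) <= D.+1)%N.
  by apply: leqW; apply: leq_trans (leq_maxr _ _); apply: leq_bigmax.
(* D bounds all degrees, and q makes the monomials in G outnumber those in the
   d variables. *)
have [q q_gt] := expn_growth D dm.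
pose k := (m * q)%N; pose w := (D * k).+1.
pose term (a : 'X_{1..m < k.+1}) := H ^+ (k - mdeg a) * mmap1 G a.
have term_size a : (msize (term a) <= w)%N.
  have ak : (mdeg a <= k)%N by have := bmdeg a; rewrite ltnS.
  rewrite /w -(subnK ak) mulnDr; apply: msizeM_leS; first exact: msizeX_leS.
  exact: msize_mmap1_leS.
pose A : 'M[K]_(#|{: 'X_{1..m < k.+1}}|, #|{: 'X_{1..d < w}}|) :=
  \matrix_(a, b) (term (enum_val a))@_(enum_val b : 'X_{1..d < w}).
have kerA0 : kermx A != 0.
  rewrite -mxrank_eq0 mxrank_ker subn_eq0 -ltnNge.
  apply: leq_ltn_trans (rank_leq_col _) _.
  apply: leq_ltn_trans (card_bmultinom_le _ _) _.
  exact: leq_trans q_gt (card_bmultinom_ge _ _).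
have [v vker v0] := rowV0Pn kerA0.
pose cf (a : 'X_{1..m < k.+1}) : K := v 0 (enum_rank a).
pose P : {mpoly K[m]} := \sum_(a : 'X_{1..m < k.+1}) cf a *: 'X_[a].
have Pcf (a : 'X_{1..m < k.+1}) : P@_a = cf a.
  rewrite /P raddf_sum /= (bigD1 a) //= mcoeffZ mcoeffX eqxx mulr1 big1 ?addr0 //.
  move=> b ba; rewrite mcoeffZ mcoeffX; case: eqP => [e|_]; last by rewrite mulr0.
  by case/eqP: ba; apply/val_inj.
exists P, k; split.
- apply: contraNneq v0 => P0; apply/eqP/rowP => i; rewrite mxE.
  by have := Pcf (enum_val i); rewrite P0 mcoeff0 /cf enum_valK => <-.
- apply: leq_trans (msize_sum _ _ _) _; apply/bigmax_leqP_seq => a _ _.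
  apply: leq_trans (msizeZ_le _ _) _; rewrite msizeX; exact: bmdeg.
rewrite /homog_eval; apply/mpolyP => b; rewrite mcoeff0 raddf_sum /=.
under eq_bigr => a _ do rewrite Pcf mcoeffCM -/(term a).
have [bw|wb] := ltnP (mdeg b) w; last first.
  rewrite big1 // => a _; rewrite (memN_msupp_eq0 (p := term a)) ?mulr0 //.
  exact: msize_mdeg_ge (leq_trans (term_size a) wb).
have /rowP /(_ (enum_rank (BMultinom bw))) : v *m A = 0 by apply/sub_kermxP.
rewrite !mxE => e; apply: etrans e.
rewrite [RHS](reindex (@enum_rank {: 'X_{1..m < k.+1}})) /=; last first.
  by exists enum_val => i _; rewrite ?enum_valK ?enum_rankK.
by apply: eq_bigr => a _; rewrite mxE !enum_rankK.
Qed.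

(** * Orthogonal eigenbases of symmetric matrices *)

Section RootProducts.
Variables (B : comNzRingType) (n s : nat).
Implicit Types (X : 'M[B]_n) (x : 'I_s -> B) (r : seq 'I_s).

Definition root_prod x X r : 'M[B]_n := \prod_(t <- r) (X - (x t)%:M).

Lemma root_prod_cons x X t r :
  root_prod x X (t :: r) = (X - (x t)%:M) *m root_prod x X r.
Proof. by rewrite /root_prod big_cons. Qed.

Lemma root_prod_comm x X (Y : 'M[B]_n) r : Y *m X = X *m Y ->
  Y *m root_prod x X r = root_prod x X r *m Y.
Proof.
move=> YX; elim: r => [|t r IH]; first by rewrite /root_prod big_nil mulmx1 mul1mx.
rewrite root_prod_cons mulmxA mulmxBr YX scalar_mxC -mulmxBl -!mulmxA.
by rewrite IH.
Qed.

Lemma tr_root_prod x X r : X^T = X -> (root_prod x X r)^T = root_prod x X r.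
Proof.
move=> Xs; elim: r => [|t r IH]; first by rewrite /root_prod big_nil trmx1.
rewrite root_prod_cons trmx_mul IH linearB /= Xs tr_scalar_mx.
by apply/esym/root_prod_comm; rewrite mulmxBl mulmxBr scalar_mxC.
Qed.

Lemma root_prod_eigen m x X r (W : 'M[B]_(n, m)) a : X *m W = a *: W ->
  root_prod x X r *m W = (\prod_(t <- r) (a - x t)) *: W.
Proof.
move=> XW; elim: r => [|t r IH].
  by rewrite /root_prod !big_nil mul1mx scale1r.
rewrite root_prod_cons -mulmxA IH -scalemxAr mulmxBl XW mul_scalar_mx.
by rewrite -scalerBl scalerA big_cons mulrC.
Qed.

End RootProducts.

(** Polarization: the entry B i j is half of a combination of values of the form. *)
Lemma quadratic_form_neq0 (F : fieldType) n (B : 'M[F]_n) :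
  2%:R != 0 :> F -> B^T = B -> B != 0 -> exists w : 'cV[F]_n, w^T *m B *m w != 0.
Proof.
move=> F2 Bs; apply: contraNP => /forallNP Q0.
have {}Q0 (w : 'cV[F]_n) : w^T *m B *m w = 0 by have /negP/negPn/eqP := Q0 w.
apply/eqP/matrixP => i j; rewrite [RHS]mxE.
pose w : 'cV[F]_n := delta_mx i 0; pose u : 'cV[F]_n := delta_mx j 0.
have entry k l : (delta_mx k 0 : 'cV[F]_n)^T *m B *m (delta_mx l 0 : 'cV[F]_n) = (B k l)%:M.
  rewrite trmx_delta -rowE -colE; apply/matrixP => a b.
  by rewrite !mxE !ord1 eqxx mulr1n.
have := Q0 (w + u); rewrite [(w + u)^T]raddfD /= mulmxDl mulmxDr !mulmxDl Q0 Q0 add0r addr0.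
rewrite !entry => /matrixP /(_ 0 0); rewrite !mxE eqxx !mulr1n -[in X in X + _]Bs mxE.
by move=> /eqP; rewrite -mulr2n -mulr_natl mulf_eq0 (negPf F2) => /eqP.
Qed.

Section OrthogonalEigenbasis.
Variables (F : fieldType) (n s : nat) (x : 'I_s -> F) (X : 'M[F]_n).
Hypothesis F2 : 2%:R != 0 :> F.
Hypothesis x_inj : injective x.
Hypothesis Xsym : X^T = X.
Hypothesis X_roots : root_prod x X (enum 'I_s) = 0.

Lemma eigen_factor (C : 'M[F]_n) : C != 0 ->
  exists t r, [/\ t \notin r, root_prod x X r *m C != 0 &
    (X - (x t)%:M) *m (root_prod x X r *m C) = 0].
Proof.
move=> C0; have := enum_uniq 'I_s.
have : root_prod x X (enum 'I_s) *m C = 0 by rewrite X_roots mul0mx.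
elim: (enum 'I_s) => [|t r IH] /=.
  by rewrite /root_prod big_nil mul1mx => /eqP; rewrite (negPf C0).
have [rC _ /andP [_ /IH]|rC0] := eqVneq (root_prod x X r *m C) 0; first exact.
rewrite root_prod_cons -mulmxA => tr0 /andP [tr _].
by exists t, r.
Qed.

(** The projection C onto the orthogonal complement of the span of W commutes
    with X, so some B = q(X) C is a nonzero symmetric matrix with X B = x_t B
    and B B = q(x_t) B; a vector Bw with (w, Bw) nonzero is then an eigenvector
    that is not isotropic. *)
Lemma orthogonal_eigenvector m (W : 'M[F]_(n, m)) (g e : 'rV[F]_m) :
  (m < n)%N -> W^T *m W = diag_mx g -> (forall a, g 0 a != 0) ->
  X *m W = W *m diag_mx e ->
  exists (v : 'cV[F]_n) t, [/\ W^T *m v = 0, X *m v = x t *: v &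
    v^T *m v != 0].
Proof.
move=> mn WW g0 XW.
pose gi := diag_mx (\row_a (g 0 a)^-1).
have ggi : diag_mx g *m gi = 1%:M.
  rewrite mulmx_diag; apply/matrixP => a b; rewrite !mxE.
  by case: eqP => // ->; rewrite mulfV.
have gigC (f : 'rV[F]_m) : gi *m diag_mx f = diag_mx f *m gi by rewrite diag_mxC.
have gis : gi^T = gi by rewrite tr_diag_mx.
pose C := 1%:M - W *m gi *m W^T.
have Cs : C^T = C by rewrite /C linearB /= trmx1 !trmx_mul trmxK gis mulmxA.
have WC : W^T *m C = 0.
  by rewrite /C mulmxBr mulmx1 !mulmxA WW ggi mul1mx subrr.
have CC : C *m C = C.
  by rewrite {1}/C mulmxBl mul1mx -!mulmxA WC !mulmx0 subr0.
have XC : X *m C = C *m X.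
  rewrite /C mulmxBl mulmxBr mulmx1 mul1mx; congr (_ - _).
  have -> : W *m gi *m W^T *m X = (X *m (W *m gi *m W^T))^T.
    by rewrite !trmx_mul trmxK gis Xsym !mulmxA.
  by rewrite !mulmxA XW !trmx_mul trmxK gis tr_diag_mx -!mulmxA (mulmxA gi) gigC !mulmxA.
have C0 : C != 0.
  apply: contraTneq mn => C0; rewrite -leqNgt.
  have : W *m (gi *m W^T) = 1%:M.
    by apply/eqP; rewrite eq_sym -subr_eq0 mulmxA; apply/eqP.
  move/(congr1 (fun M => \rank M)); rewrite mxrank1 => <-.
  exact: leq_trans (mxrankM_maxl _ _) (rank_leq_col _).
have [t [r [tr B0 XB]]] := eigen_factor C0.
set B := root_prod x X r *m C in B0 XB.
have qC : C *m root_prod x X r = root_prod x X r *m C.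
  by apply: root_prod_comm; rewrite XC.
have Bs : B^T = B by rewrite /B trmx_mul Cs tr_root_prod.
have {}XB : X *m B = x t *: B.
  by apply/eqP; rewrite -subr_eq0 -mul_scalar_mx -mulmxBl XB.
have BB : B *m B = (\prod_(u <- r) (x t - x u)) *: B.
  rewrite {1}/B -qC -mulmxA (root_prod_eigen _ _ XB) -scalemxAr; congr (_ *: _).
  by rewrite /B -qC mulmxA CC.
have q0 : \prod_(u <- r) (x t - x u) != 0.
  rewrite prodf_seq_neq0; apply/allP => u ur /=; rewrite subr_eq0.
  by apply: contraNneq tr => /x_inj ->.
have [w w0] := quadratic_form_neq0 F2 Bs B0.
exists (B *m w), t; split.
- by rewrite mulmxA /B -qC mulmxA WC !mul0mx.
- by rewrite mulmxA XB -scalemxAl.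
- rewrite trmx_mul Bs -mulmxA (mulmxA B) BB -scalemxAl -scalemxAr mulmxA.
  by rewrite scaler_eq0 negb_or q0.
Qed.

Lemma orthogonal_eigenbasis :
  exists (Q : 'M[F]_n) (g : 'rV[F]_n) (e : 'I_n -> 'I_s),
    [/\ Q^T *m Q = diag_mx g, forall a, g 0 a != 0 &
        X *m Q = Q *m diag_mx (\row_a x (e a))].
Proof.
suff /(_ n (leqnn n)) : forall m, (m <= n)%N ->
  exists (Q : 'M[F]_(n, m)) (g : 'rV[F]_m) (e : 'I_m -> 'I_s),
    [/\ Q^T *m Q = diag_mx g, forall a, g 0 a != 0 &
        X *m Q = Q *m diag_mx (\row_a x (e a))] by [].
elim=> [_|m IH mn].
  have e0 : 'I_0 -> 'I_s by case.
  exists 0, 0, e0; split; [| by case |]; apply/matrixP.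
    by case.
  by move=> i [].
have [W [g [e [WW g0 XW]]]] := IH (ltnW mn).
have [v [t [Wv Xv vv]]] := orthogonal_eigenvector mn WW g0 XW.
have [a ea] : exists a, v^T *m v = a%:M by exists ((v^T *m v) 0 0); rewrite -mx11_scalar.
rewrite -addn1.
pose g' : 'rV[F]_(m + 1) := row_mx g a%:M.
pose e' (i : 'I_(m + 1)) := if split i is inl j then e j else t.
exists (row_mx W v), g', e'; split.
- rewrite tr_row_mx mul_col_row WW Wv ea diag_mx_row; congr block_mx.
    by rewrite -[W]trmxK -trmx_mul Wv trmx0.
  by apply/matrixP => i j; rewrite !mxE !ord1.
- move=> i; rewrite /g' mxE; case: splitP => j _; first exact: g0.
  rewrite ord1 mxE eqxx mulr1n; apply: contraNneq vv => a0.
  by rewrite ea a0 raddf0.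
have -> : \row_i x (e' i) = row_mx (\row_i x (e i)) (x t)%:M.
  apply/rowP => i; rewrite !mxE /e'; case: splitP => j _; rewrite mxE //.
  by rewrite ord1 eqxx mulr1n.
rewrite diag_mx_row mul_row_block mul_mx_row !mulmx0 addr0 add0r XW Xv.
congr row_mx; apply/matrixP => i j.
rewrite !mxE big_ord1 !mxE !ord1 eqxx !mulr1n mulrC.
by [].
Qed.

End OrthogonalEigenbasis.

(** * Orthogonalized flags *)

Section Blocks.
Variables (B : comNzRingType) (n s : nat) (rho : 'I_n -> 'I_s).
Implicit Types (M : 'M[B]_n) (t u : nat).

Definition flag_coord t : 'M[B]_n := diag_mx (\row_a (rho a < t)%:R).
Definition block_coord (t : 'I_s) : 'M[B]_n := diag_mx (\row_a (rho a == t)%:R).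
Definition block_scalar (x : 'I_s -> B) : 'M[B]_n := diag_mx (\row_a x (rho a)).

Local Notation E := flag_coord.

Lemma flag_coord_min t u : E t *m E u = E (minn t u).
Proof.
rewrite mulmx_diag; congr diag_mx; apply/rowP => a; rewrite !mxE.
by rewrite -natrM mulnb leq_min.
Qed.

Lemma flag_coord_idem t : E t *m E t = E t.
Proof. by rewrite flag_coord_min minnn. Qed.

Lemma tr_flag_coord t : (E t)^T = E t.
Proof. exact: tr_diag_mx. Qed.

Lemma flag_coord0 : E 0 = 0.
Proof. by apply/matrixP => a b; rewrite !mxE mul0rn. Qed.

Lemma flag_coord_full : E s = 1%:M.
Proof. by apply/matrixP => a b; rewrite !mxE ltn_ord. Qed.

Lemma block_coordE (t : 'I_s) : block_coord t = E t.+1 - E t.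
Proof.
apply/matrixP => a b; rewrite !mxE -mulrnBl ltnS leq_eqVlt -(inj_eq val_inj).
by case: ltngtP => //=; rewrite ?subr0 ?subrr.
Qed.

Lemma block_coordM (t u : 'I_s) :
  block_coord t *m block_coord u = if t == u then block_coord t else 0.
Proof.
rewrite mulmx_diag; case: eqP => [->|tu]; apply/matrixP => a b; rewrite !mxE.
  by case: (rho a == u); rewrite ?mulr1 ?mulr0.
by case: eqP => [->|_]; rewrite ?mul0r ?mul0rn //; case: eqP => // _; rewrite mulr0 mul0rn.
Qed.

Lemma sum_block_coord (x : 'I_s -> B) : \sum_t x t *: block_coord t = block_scalar x.
Proof.
apply/matrixP => a b; rewrite summxE !mxE (bigD1 (rho a)) //= big1 ?addr0.
  by rewrite !mxE eqxx mulr1n mulr_natr.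
by move=> t ta; rewrite !mxE eq_sym (negPf ta) mul0rn mulr0.
Qed.

Lemma sum_block_coord1 : \sum_t block_coord t = 1%:M.
Proof.
have := sum_block_coord (fun=> 1); under eq_bigr => t _ do rewrite scale1r.
by move=> ->; apply/matrixP => a b; rewrite !mxE.
Qed.

(** The Gram matrix of the columns that span step t of the flag, completed by an
    identity block so that its size does not depend on t. *)
Definition flag_gram t M := E t *m (M^T *m M) *m E t + (1%:M - E t).

Lemma flag_gramE t M : flag_gram t M *m E t = E t *m (M^T *m M) *m E t.
Proof.
by rewrite /flag_gram mulmxDl mulmxBl mul1mx -mulmxA !flag_coord_idem subrr addr0.
Qed.

Lemma tr_flag_gram t M : (flag_gram t M)^T = flag_gram t M.
Proof.
by rewrite /flag_gram linearD linearB /= trmx1 !trmx_mul trmxK tr_flag_coord !mulmxA.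
Qed.

Definition flag_det t M := \det (flag_gram t M).

Lemma flag_det_full M : flag_det s M = \det M ^+ 2.
Proof.
rewrite /flag_det /flag_gram flag_coord_full mul1mx mulmx1 subrr addr0.
by rewrite det_mulmx det_tr.
Qed.

(** [flag_det t M] times the orthogonal projection onto the span of the
    columns a of M with rho a < t. *)
Definition flag_proj_num t M := M *m E t *m \adj (flag_gram t M) *m E t *m M^T.

(** Numerator and denominator of the symmetric matrix with eigenvalues x whose
    partial sums of eigenspaces are the flag spanned by the columns of M.  The
    additional factor, which is the square of the determinant of M, makes
    [flag_num_orthogonal] hold over rings where M need not be invertible. *)
Definition flag_denom M := flag_det s M * \prod_(t < s.+1) flag_det t M.
Definition flag_num (x : 'I_s -> B) M := flag_det s M *: \sum_(t < s) x t *: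
  ((\prod_(u < s.+1 | u != t.+1 :> nat) flag_det u M) *: flag_proj_num t.+1 M
   - (\prod_(u < s.+1 | u != t :> nat) flag_det u M) *: flag_proj_num t M).

Lemma prod_flag_det t M : (t < s.+1)%N ->
  (\prod_(u < s.+1 | u != t :> nat) flag_det u M) * flag_det t M =
  \prod_(u < s.+1) flag_det u M.
Proof. by move=> ts; rewrite [RHS](bigD1 (Ordinal ts)) //= mulrC. Qed.

(** On a matrix U that is already block-orthogonal, orthogonalizing the flag
    changes nothing, so the eigenspaces are the blocks of columns of U. *)
Lemma flag_num_orthogonal (x : 'I_s -> B) (X U : 'M[B]_n) :
  (forall t, U^T *m U *m E t = E t *m (U^T *m U)) ->
  X *m U = U *m block_scalar x ->
  flag_num x U = flag_denom U *: X.
Proof.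
move=> GE XU.
have projU t : flag_proj_num t U *m U = flag_det t U *: (U *m E t).
  have EG : E t *m (U^T *m U) = flag_gram t U *m E t.
    by rewrite flag_gramE -mulmxA GE [RHS]mulmxA flag_coord_idem.
  rewrite /flag_proj_num -!mulmxA EG (mulmxA (\adj _)) mul_adj_mx mul_scalar_mx.
  by rewrite -!scalemxAr flag_coord_idem.
have adjU (Y Z : 'M[B]_n) : Y *m U = Z *m U -> \det U ^+ 2 *: Y = \det U ^+ 2 *: Z.
  move=> YZ; rewrite expr2 -!scalerA; congr (_ *: _).
  by rewrite -!mul_mx_scalar -(mul_mx_adj U) !mulmxA YZ.
(* It suffices to compare both sides after multiplication by U. *)
rewrite /flag_num /flag_denom flag_det_full -[RHS]scalerA; apply: adjU.
rewrite -scalemxAl XU -sum_block_coord mulmx_sumr scaler_sumr mulmx_suml.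
apply: eq_bigr => t _; rewrite -scalemxAl -scalemxAr scalerA mulrC -scalerA.
congr (_ *: _).
rewrite mulmxBl -!scalemxAl !projU !scalerA !prod_flag_det ?ltnS ?(ltnW (ltn_ord t)) // -scalerBr.
by rewrite -mulmxBr -block_coordE.
Qed.
End Blocks.

Section BlocksMorphism.
Variables (B B' : comNzRingType) (phi : {rmorphism B -> B'}) (n s : nat).
Variable rho : 'I_n -> 'I_s.
Implicit Types (M X : 'M[B]_n).

Lemma map_flag_coord t : map_mx phi (flag_coord B rho t) = flag_coord B' rho t.
Proof. by apply/matrixP => a b; rewrite !mxE rmorphMn rmorph_nat. Qed.

Lemma map_block_coord t : map_mx phi (block_coord B rho t) = block_coord B' rho t.
Proof. by apply/matrixP => a b; rewrite !mxE rmorphMn rmorph_nat. Qed.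

Lemma map_flag_gram t M : map_mx phi (flag_gram rho t M) = flag_gram rho t (map_mx phi M).
Proof.
by rewrite /flag_gram map_mxD map_mxB !map_mxM map_mx1 !map_flag_coord map_trmx.
Qed.

Lemma map_flag_det t M : phi (flag_det rho t M) = flag_det rho t (map_mx phi M).
Proof. by rewrite /flag_det -map_flag_gram det_map_mx. Qed.

Lemma map_flag_proj_num t M :
  map_mx phi (flag_proj_num rho t M) = flag_proj_num rho t (map_mx phi M).
Proof.
by rewrite /flag_proj_num !map_mxM map_mx_adj map_flag_gram !map_flag_coord map_trmx.
Qed.

Lemma map_flag_denom M : phi (flag_denom rho M) = flag_denom rho (map_mx phi M).
Proof.
rewrite rmorphM rmorph_prod map_flag_det; congr (_ * _).
by apply: eq_bigr => t _; rewrite map_flag_det.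
Qed.

Lemma map_mx_sum (I : finType) (P : pred I) (F : I -> 'M[B]_n) :
  map_mx phi (\sum_(i | P i) F i) = \sum_(i | P i) map_mx phi (F i).
Proof. exact: raddf_sum. Qed.

Lemma map_flag_num (x : 'I_s -> B) M :
  map_mx phi (flag_num rho x M) = flag_num rho (phi \o x) (map_mx phi M).
Proof.
rewrite /flag_num map_mxZ map_flag_det; congr (_ *: _).
rewrite map_mx_sum; apply: eq_bigr => t _.
rewrite map_mxZ map_mxB !map_mxZ !map_flag_proj_num !rmorph_prod.
by do 2![congr (_ *: _)|congr (_ - _)]; congr (_ *: _); apply: eq_bigr => u _; rewrite map_flag_det.
Qed.

Lemma map_root_prod (x : 'I_s -> B) X r :
  map_mx phi (root_prod x X r) = root_prod (phi \o x) (map_mx phi X) r.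
Proof.
elim: r => [|t r IH]; first by rewrite /root_prod !big_nil map_mx1.
by rewrite !root_prod_cons map_mxM IH map_mxB map_scalar_mx.
Qed.

End BlocksMorphism.

(** * Adapted frames: from a symmetric matrix back to its eigenspaces *)

Section AdaptedFrame.
Variables (B : comNzRingType) (n s : nat) (rho : 'I_n -> 'I_s) (x : 'I_s -> B).
Implicit Types (X Q : 'M[B]_n).

(** Up to a scalar, the t-th product is the projection onto the eigenspace of
    x t, so this projects each column of Q to the eigenspace of its block. *)
Definition eigenframe X Q : 'M[B]_n :=
  \sum_t root_prod x X [seq u <- enum 'I_s | u != t] *m Q *m block_coord B rho t.

Lemma root_prod_perm X r r' : perm_eq r r' -> root_prod x X r = root_prod x X r'.
Proof.
have swap t u r0 : root_prod x X (t :: u :: r0) = root_prod x X (u :: t :: r0).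
  rewrite !root_prod_cons !mulmxA; congr (_ *m _).
  have := @root_prod_comm _ _ _ x X (X - (x u)%:M) [:: t].
  rewrite root_prod_cons /root_prod big_nil mulmx1 => -> //.
  by rewrite mulmxBl mulmxBr scalar_mxC.
have pull t r1 r2 : root_prod x X (r1 ++ t :: r2) = root_prod x X (t :: r1 ++ r2).
  by elim: r1 => //= u r1 IH; rewrite root_prod_cons IH -root_prod_cons swap.
elim: r r' => [|t r IH] r' pr.
  by have /perm_size := pr; case: r' pr.
have tr' : t \in r' by rewrite -(perm_mem pr) mem_head.
have [r1 [r2 e]] : exists r1 r2, r' = r1 ++ t :: r2.
  by case/splitPr: tr' => r1 r2; exists r1, r2.
rewrite e pull !root_prod_cons (IH (r1 ++ r2)) //.
by move: pr; rewrite e -[t :: r2]cat1s perm_sym perm_catCA /= perm_cons perm_sym.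
Qed.

Lemma eigenframe_eigen X Q : root_prod x X (enum 'I_s) = 0 ->
  X *m eigenframe X Q = eigenframe X Q *m block_scalar rho x.
Proof.
move=> X0; rewrite -sum_block_coord /eigenframe mulmx_sumr mulmx_suml.
apply: eq_bigr => t _; rewrite mulmx_sumr (bigD1 t) //= big1 ?addr0; last first.
  by move=> u ut; rewrite -scalemxAr -(mulmxA _ (block_coord B rho t)) block_coordM eq_sym (negPf ut) mulmx0 scaler0.
rewrite -scalemxAr -(mulmxA _ (block_coord B rho t)) block_coordM eqxx.
have : root_prod x X (t :: [seq u <- enum 'I_s | u != t]) = 0.
  rewrite -X0; apply: root_prod_perm; apply: uniq_perm; rewrite ?enum_uniq //.
    by rewrite /= mem_filter eqxx filter_uniq ?enum_uniq.
  by move=> u; rewrite inE mem_filter mem_enum andbT orbN.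
rewrite root_prod_cons mulmxBl => /eqP; rewrite subr_eq0 => /eqP e.
by rewrite !mulmxA e mul_scalar_mx !scalemxAl.
Qed.

Hypothesis x_reg : forall t u b, t != u -> (x t - x u) * b = 0 -> b = 0.

(** Eigenspaces of a symmetric matrix for different eigenvalues are orthogonal;
    differences of eigenvalues only have to be regular, as in an algebra over a
    field that contains the eigenvalues. *)
Lemma eigenframe_orthogonal X U t : X^T = X -> X *m U = U *m block_scalar rho x ->
  U^T *m U *m flag_coord B rho t = flag_coord B rho t *m (U^T *m U).
Proof.
move=> Xs XU; set G := U^T *m U.
have GX : G *m block_scalar rho x = block_scalar rho x *m G.
  have -> : G *m block_scalar rho x = U^T *m X *m U by rewrite /G -!mulmxA XU.
  rewrite -[block_scalar rho x]tr_diag_mx /G mulmxA -trmx_mul -XU trmx_mul Xs.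
  by [].
have G0 a b : rho a != rho b -> G a b = 0.
  move=> ab; apply: (x_reg ab); have /matrixP /(_ a b) := GX.
  rewrite mul_mx_diag mul_diag_mx !mxE => /eqP; rewrite mulrC -subr_eq0 -mulrBl.
  by move/eqP => e; rewrite -opprB mulNr e oppr0.
move: (G) G0 => H H0; apply/matrixP => a b; rewrite mul_mx_diag mul_diag_mx !mxE.
by case: (eqVneq (rho a) (rho b)) => [->|/H0 ->]; rewrite ?mul0r ?mulr0 // mulrC.
Qed.

End AdaptedFrame.

Lemma map_eigenframe (B B' : comNzRingType) (phi : {rmorphism B -> B'}) n s
    (rho : 'I_n -> 'I_s) (x : 'I_s -> B) X Q :
  map_mx phi (eigenframe rho x X Q) =
  eigenframe rho (phi \o x) (map_mx phi X) (map_mx phi Q).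
Proof.
rewrite /eigenframe map_mx_sum; apply: eq_bigr => t _.
by rewrite !map_mxM map_root_prod map_block_coord.
Qed.

(** * Flags over a field *)

Section FlagField.
Variables (F : fieldType) (n s : nat) (rho : 'I_n -> 'I_s).
Implicit Types (M X Q : 'M[F]_n) (x : 'I_s -> F).
Local Notation E := (flag_coord F rho).

Definition flag_proj t M : 'M[F]_n := M *m E t *m invmx (flag_gram rho t M) *m E t *m M^T.

Definition flag_point x M := \sum_(t < s) x t *: (flag_proj t.+1 M - flag_proj t M).

Lemma flag_denom_neq0 M :
  (flag_denom rho M != 0) = [forall t : 'I_s.+1, flag_det rho t M != 0].
Proof.
rewrite /flag_denom mulf_eq0 negb_or prodf_seq_neq0.
apply/andP/forallP => [[_ /allP h] t|h]; first by apply: h; rewrite mem_index_enum.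
by split; [exact: (h ord_max)|apply/allP => t _; exact: h].
Qed.

Lemma flag_gram_unit M t : flag_denom rho M != 0 -> (t <= s)%N ->
  flag_gram rho t M \in unitmx.
Proof.
rewrite flag_denom_neq0 -ltnS => /forallP h ts.
by have := h (Ordinal ts); rewrite /flag_det unitmxE unitfE.
Qed.

Lemma flag_num_field x M : flag_denom rho M != 0 ->
  flag_num rho x M = flag_denom rho M *: flag_point x M.
Proof.
move=> M0; rewrite /flag_num /flag_denom -scalerA; congr (_ *: _).
rewrite scaler_sumr; apply: eq_bigr => t _; rewrite [RHS]scalerA mulrC -scalerA; congr (_ *: _).
have projE u : (u <= s)%N -> flag_proj_num rho u M = flag_det rho u M *: flag_proj u M.
  move=> us; have uN := flag_gram_unit M0 us.
  rewrite /flag_proj_num /flag_proj /invmx uN -scalemxAr -!scalemxAl scalerA.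
  by rewrite mulfV ?scale1r //; move: uN; rewrite unitmxE unitfE.
rewrite !projE ?ltn_ord ?(ltnW (ltn_ord t)) // !scalerA.
by rewrite !prod_flag_det ?ltnS ?ltn_ord ?(ltnW (ltn_ord t)) // scalerBr.
Qed.

Section AtPoint.
Variable M : 'M[F]_n.
Hypothesis M0 : flag_denom rho M != 0.

Lemma tr_flag_proj t : (flag_proj t M)^T = flag_proj t M.
Proof.
by rewrite /flag_proj !trmx_mul trmxK trmx_inv tr_flag_gram !tr_flag_coord !mulmxA.
Qed.

Lemma flag_proj_frame t : (t <= s)%N -> flag_proj t M *m (M *m E t) = M *m E t.
Proof.
move=> ts; rewrite /flag_proj -!mulmxA.
have -> : E t *m (M^T *m (M *m E t)) = flag_gram rho t M *m E t.
  by rewrite flag_gramE !mulmxA.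
by rewrite (mulmxA (invmx _)) mulVmx ?mul1mx ?flag_coord_idem //; apply: flag_gram_unit.
Qed.

Lemma flag_proj_nested t u : (t <= u <= s)%N ->
  flag_proj u M *m flag_proj t M = flag_proj t M.
Proof.
move=> /andP [tu us].
have ME : M *m E t = M *m E u *m E t by rewrite -mulmxA flag_coord_min (minn_idPr tu).
by rewrite {2}/flag_proj ME !mulmxA -(mulmxA (flag_proj u M)) flag_proj_frame // -ME.
Qed.

Lemma flag_proj_nested_r t u : (t <= u <= s)%N ->
  flag_proj t M *m flag_proj u M = flag_proj t M.
Proof.
by move=> tus; apply: trmx_inj; rewrite trmx_mul !tr_flag_proj flag_proj_nested.
Qed.

Lemma flag_proj0 : flag_proj 0 M = 0.
Proof. by rewrite /flag_proj flag_coord0 mulmx0 !mul0mx. Qed.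

Lemma flag_proj_full : flag_proj s M = 1%:M.
Proof.
have uM : M \in unitmx.
  have := flag_gram_unit M0 (leqnn s); rewrite !unitmxE.
  by rewrite -/(flag_det _ _ _) flag_det_full unitfE expf_eq0 -unitfE.
by have := flag_proj_frame (leqnn s); rewrite flag_coord_full mulmx1 => /(canRL (mulmxK uM)) ->;
  rewrite mulmxV.
Qed.

Lemma mxtrace_flag_proj t : (t <= s)%N -> \tr (flag_proj t M) = \tr (E t).
Proof.
move=> ts; rewrite /flag_proj -[_ *m M^T]mulmxA -[_ *m _ *m (E t *m M^T)]mulmxA mxtrace_mulC.
have -> : invmx (flag_gram rho t M) *m (E t *m M^T) *m (M *m E t) =
    invmx (flag_gram rho t M) *m (flag_gram rho t M *m E t).
  by rewrite flag_gramE !mulmxA.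
by rewrite mulmxA mulVmx ?mul1mx //; apply: flag_gram_unit.
Qed.

Definition flag_step (t : 'I_s) := flag_proj t.+1 M - flag_proj t M.

Lemma flag_stepM (t u : 'I_s) :
  flag_step t *m flag_step u = if t == u then flag_step t else 0.
Proof.
have nest v w : (v <= s)%N -> (w <= s)%N ->
    flag_proj v M *m flag_proj w M = flag_proj (minn v w) M.
  move=> vs ws; case: (leqP v w) => [vw|/ltnW vw].
    by apply: flag_proj_nested_r; rewrite vw ws.
  by apply: flag_proj_nested; rewrite vw vs.
have ts : (t.+1 <= s)%N := ltn_ord t; have us : (u.+1 <= s)%N := ltn_ord u.
have ts' := ltnW ts; have us' := ltnW us.
rewrite /flag_step mulmxBl !mulmxBr (nest _ _ ts us) (nest _ _ ts us').
rewrite (nest _ _ ts' us) (nest _ _ ts' us') minnSS -(inj_eq (@ord_inj s)).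
case: ltngtP => [tu|ut|->].
- have tu' : (t <= u)%N := ltnW tu.
  by rewrite (minn_idPl tu) (minn_idPl (leqW tu')) !subrr.
- have ut' : (u <= t)%N := ltnW ut.
  by rewrite (minn_idPr ut) (minn_idPr (leqW ut')) subrr.
- by rewrite ?minnn (minn_idPl (leqnSn u)) (minn_idPr (leqnSn u)) subrr subr0.
Qed.

Lemma sum_flag_step : \sum_t flag_step t = 1%:M.
Proof.
rewrite -(big_mkord xpredT (fun t => flag_proj t.+1 M - flag_proj t M)).
by rewrite telescope_sumr // flag_proj0 flag_proj_full subr0.
Qed.

Lemma tr_flag_point x : (flag_point x M)^T = flag_point x M.
Proof.
rewrite /flag_point raddf_sum; apply: eq_bigr => t _.
by rewrite /= linearZ /= linearB /= !tr_flag_proj.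
Qed.

Lemma flag_point_roots x : root_prod x (flag_point x M) (enum 'I_s) = 0.
Proof.
rewrite -[LHS]mulmx1 -sum_flag_step mulmx_sumr big1 // => t _.
rewrite (@root_prod_eigen _ _ _ _ _ _ _ _ (x t)); last first.
  rewrite /flag_point mulmx_suml (bigD1 t) //= big1 ?addr0.
    by rewrite -scalemxAl flag_stepM eqxx.
  by move=> u ut; rewrite -scalemxAl flag_stepM (negPf ut) scaler0.
by rewrite (big_rem t) ?mem_enum //= subrr mul0r scale0r.
Qed.

Lemma mxtrace_flag_point x : \tr (flag_point x M) = \sum_a x (rho a).
Proof.
transitivity (\tr (block_scalar rho x)); last first.
  by rewrite mxtrace_diag; apply: eq_bigr => a _; rewrite mxE.
rewrite -sum_block_coord /flag_point !raddf_sum; apply: eq_bigr => t _ /=.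
rewrite !mxtraceZ raddfB /= (mxtrace_flag_proj (ltn_ord t)).
by rewrite (mxtrace_flag_proj (ltnW (ltn_ord t))) block_coordE raddfB.
Qed.

End AtPoint.

Lemma flag_denom_orthogonal Q g : Q^T *m Q = diag_mx g -> (forall a, g 0 a != 0) ->
  flag_denom rho Q != 0.
Proof.
move=> QQ g0; rewrite flag_denom_neq0; apply/forallP => t.
pose d : 'rV[F]_n := \row_a (if (rho a < t)%N then g 0 a else 1).
have -> : flag_det rho t Q = \det (diag_mx d).
  rewrite /flag_det /flag_gram QQ !mulmx_diag; congr (\det _).
  apply/matrixP => a b; rewrite !mxE; case: ltnP => _.
    by rewrite mul1r mulr1 subrr addr0.
  by rewrite !mul0r !mul0rn add0r subr0.
rewrite det_diag; apply/prodf_neq0 => a _; rewrite mxE.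
by case: ifP => // _; rewrite ?oner_eq0.
Qed.

Lemma flag_point_frame x X Q g : Q^T *m Q = diag_mx g -> (forall a, g 0 a != 0) ->
  X *m Q = Q *m block_scalar rho x -> flag_point x Q = X.
Proof.
move=> QQ g0 XQ; have Q0 := flag_denom_orthogonal QQ g0.
apply: (scalerI Q0); rewrite -flag_num_field //; apply: flag_num_orthogonal => // t.
by rewrite QQ diag_mxC.
Qed.

Lemma flag_denom_eigenframe x X Q g : injective x ->
  Q^T *m Q = diag_mx g -> (forall a, g 0 a != 0) ->
  X *m Q = Q *m block_scalar rho x ->
  flag_denom rho (eigenframe rho x X Q) != 0.
Proof.
move=> x_inj QQ g0 XQ.
pose q t := \prod_(u <- [seq u <- enum 'I_s | u != t]) (x t - x u).
have q0 t : q t != 0.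
  rewrite prodf_seq_neq0; apply/allP => u; rewrite mem_filter => /andP [ut _] /=.
  by rewrite subr_eq0; apply: contraNneq ut => /x_inj ->.
have -> : eigenframe rho x X Q = Q *m block_scalar rho q.
  rewrite -sum_block_coord mulmx_sumr; apply: eq_bigr => t _.
  rewrite -mulmxA (@root_prod_eigen _ _ _ _ _ _ _ _ (x t)) -?scalemxAr //.
  rewrite mulmxA XQ -mulmxA scalemxAr; congr (_ *m _).
  rewrite -sum_block_coord mulmx_suml (bigD1 t) //= big1 ?addr0.
    by rewrite -scalemxAl block_coordM eqxx.
  by move=> u ut; rewrite -scalemxAl block_coordM (negPf ut) scaler0.
apply: (@flag_denom_orthogonal _ (\row_a (q (rho a) * g 0 a * q (rho a)))).
  rewrite trmx_mul tr_diag_mx mulmxA -(mulmxA _ Q^T) QQ !mulmx_diag; congr diag_mx.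
  by apply/rowP => a; rewrite !mxE.
by move=> a; rewrite mxE !mulf_neq0.
Qed.

End FlagField.

(** * Block triangular reduction of a frame *)

Section Reduction.
Variables (B : comNzRingType) (n s : nat) (rho : 'I_n -> 'I_s).
Implicit Types (M : 'M[B]_n) (t u : nat).
Local Notation E := (flag_coord B rho).

Definition corner t M := E t *m M *m E t + (1%:M - E t).

Lemma cornerE t M : corner t M *m E t = E t *m M *m E t.
Proof.
by rewrite /corner mulmxDl mulmxBl mul1mx -mulmxA !flag_coord_idem subrr addr0.
Qed.

Lemma cornerC t M : corner t M *m E t = E t *m corner t M.
Proof.
rewrite cornerE /corner mulmxDr mulmxBr mulmx1 !mulmxA !flag_coord_idem.
by rewrite subrr addr0.
Qed.

(** Column operations inside the flag that bring the columns of each block to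
    echelon form, up to the scalar [corner_prod M]. *)
Definition corner_prod M := \prod_(u < s.+1) \det (corner u M).
Definition reducer M := \sum_(t < s)
  (\prod_(u < s.+1 | u != t.+1 :> nat) \det (corner u M)) *:
    (\adj (corner t.+1 M) *m block_coord B rho t).

Definition reduction_denom M := flag_denom rho M * corner_prod M *
  \prod_(t < s.+1) \det (E t *m reducer M *m E t + corner_prod M *: (1%:M - E t)).

Lemma corner1 t : corner t 1%:M = 1%:M.
Proof. by rewrite /corner mulmx1 flag_coord_idem addrC subrK. Qed.

Lemma reduction_denom1 : reduction_denom 1%:M = 1.
Proof.
have gram1 t : flag_gram rho t (1%:M : 'M[B]_n) = 1%:M.
  by rewrite /flag_gram trmx1 mulmx1 mulmx1 flag_coord_idem addrC subrK.
have det1t t : flag_det rho t (1%:M : 'M[B]_n) = 1 by rewrite /flag_det gram1 det1.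
have prod1 (P : pred 'I_s.+1) (f : nat -> B) : (forall u, f u = 1) -> \prod_(u < s.+1 | P u) f u = 1.
  by move=> f1; rewrite big1.
have corner_det1 t : \det (corner t (1%:M : 'M[B]_n)) = 1 by rewrite corner1 det1.
have red1 : reducer 1%:M = 1%:M.
  rewrite -[RHS](sum_block_coord1 B rho); apply: eq_bigr => t _.
  rewrite corner1 (prod1 _ _ corner_det1) scale1r.
  by have := mul_adj_mx (1%:M : 'M[B]_n); rewrite mulmx1 det1 => ->; rewrite mul1mx.
rewrite /reduction_denom /corner_prod /flag_denom red1 !(prod1 _ _ corner_det1) (prod1 _ _ det1t) det1t !mul1r.
rewrite big1 // => t _; rewrite mulmx1 flag_coord_idem scale1r.
by rewrite addrC subrK det1.
Qed.

End Reduction.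

Lemma map_reduction_denom (B B' : comNzRingType) (phi : {rmorphism B -> B'}) n s
    (rho : 'I_n -> 'I_s) M :
  phi (reduction_denom rho M) = reduction_denom rho (map_mx phi M).
Proof.
have mapc t : map_mx phi (corner rho t M) = corner rho t (map_mx phi M).
  by rewrite /corner map_mxD map_mxB !map_mxM map_mx1 map_flag_coord.
have mapp : phi (corner_prod rho M) = corner_prod rho (map_mx phi M).
  by rewrite rmorph_prod; apply: eq_bigr => t _; rewrite -det_map_mx mapc.
have mapr : map_mx phi (reducer rho M) = reducer rho (map_mx phi M).
  rewrite /reducer map_mx_sum; apply: eq_bigr => t _.
  rewrite map_mxZ map_mxM map_mx_adj mapc map_block_coord; congr (_ *: _).
  by rewrite rmorph_prod; apply: eq_bigr => u _; rewrite -det_map_mx mapc.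
rewrite /reduction_denom 2!rmorphM map_flag_denom mapp; congr (_ * _).
rewrite rmorph_prod; apply: eq_bigr => t _; rewrite -det_map_mx map_mxD !map_mxM.
by rewrite map_mxZ map_mxB map_mx1 map_flag_coord mapr mapp.
Qed.

(** L is M times the matrix T that [reducer] computes up to a scalar.  As T
    preserves each step E t, the frames L and M span the same flag, and T is
    chosen to invert the upper left corners of M, which gives L its shape. *)
Lemma reduced_frame (F : fieldType) n s (rho : 'I_n -> 'I_s) (M : 'M[F]_n) x :
  reduction_denom rho M != 0 ->
  exists L : 'M[F]_n, [/\ flag_denom rho L != 0,
    flag_point rho x L = flag_point rho x M &
    forall a b, (rho a <= rho b)%N -> L a b = (a == b)%:R].
Proof.
rewrite /reduction_denom mulf_eq0 negb_or => /andP [+ d0].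
rewrite mulf_eq0 negb_or => /andP [h0 k0].
pose E := flag_coord F rho; pose K t := corner rho t M.
have uK t : (t <= s)%N -> K t \in unitmx.
  rewrite -ltnS => ts; rewrite unitmxE unitfE.
  by move: k0; rewrite /corner_prod prodf_seq_neq0 => /allP /(_ (Ordinal ts)); apply; rewrite mem_index_enum.
pose T := \sum_(t < s) invmx (K t.+1) *m block_coord F rho t.
have redT : reducer rho M = corner_prod rho M *: T.
  rewrite /reducer /T scaler_sumr; apply: eq_bigr => t _.
  rewrite scalemxAl; rewrite {1}/invmx uK // scalemxAl; congr (_ *m _).
  have ts : (t.+1 < s.+1)%N by rewrite ltnS.
  have K0 : \det (K t.+1) != 0 by have := uK _ (ltn_ord t); rewrite unitmxE unitfE.
  rewrite scalerA; congr (_ *: _).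
  by rewrite /corner_prod [in RHS](bigD1 (Ordinal ts)) //= mulrAC mulfV ?mul1r.
have invKE t : (t <= s)%N -> invmx (K t) *m E t = E t *m invmx (K t).
  move=> ts; apply: (canLR (mulKmx (uK t ts))).
  by rewrite mulmxA cornerC -mulmxA mulmxV ?mulmx1 //; apply: uK.
have EB (t : 'I_s) : E t.+1 *m block_coord F rho t = block_coord F rho t.
  by rewrite block_coordE mulmxBr !flag_coord_min minnn (minn_idPr (leqnSn t)).
have BE (u : 'I_s) t : block_coord F rho u *m E t = if (u < t)%N then block_coord F rho u else 0.
  rewrite mulmx_diag; case: (ltnP u t) => ut; apply/matrixP => a b; rewrite !mxE.
    by case: eqP => [->|_]; rewrite ?ut ?mulr1 ?mul0r.
  by case: eqP => [->|_]; rewrite ?mul0r ?mul0rn // ltnNge ut mulr0 mul0rn.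
have TB (t : 'I_s) : T *m block_coord F rho t = invmx (K t.+1) *m block_coord F rho t.
  rewrite /T mulmx_suml (bigD1 t) //= big1 ?addr0.
    by rewrite -mulmxA block_coordM eqxx.
  by move=> u ut; rewrite -mulmxA block_coordM (negPf ut) mulmx0.
have ET t : T *m E t = E t *m T *m E t.
  rewrite -mulmxA /T mulmx_suml mulmx_sumr; apply: eq_bigr => u _.
  rewrite -mulmxA BE; case: ltnP => [ut|_]; last by rewrite !mulmx0.
  have e : invmx (K u.+1) *m block_coord F rho u =
      E u.+1 *m (invmx (K u.+1) *m block_coord F rho u).
    by rewrite -[in LHS]EB !mulmxA (invKE _ (ltn_ord u)).
  by rewrite e [RHS]mulmxA flag_coord_min (minn_idPr ut).
pose L := M *m T; pose T' t := corner rho t T.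
have uT t : (t <= s)%N -> T' t \in unitmx.
  rewrite -ltnS => ts; rewrite unitmxE unitfE.
  move: d0; rewrite prodf_seq_neq0 => /allP /(_ (Ordinal ts)).
  rewrite mem_index_enum redT -scalemxAr -scalemxAl -scalerDr detZ => /(_ isT) /=.
  by rewrite mulf_eq0 negb_or => /andP [].
have LE t : L *m E t = M *m E t *m T' t.
  by rewrite /L -mulmxA ET -[in RHS]mulmxA -cornerC cornerE.
have LtE t : E t *m L^T = (T' t)^T *m (E t *m M^T).
  by apply: trmx_inj; rewrite !trmx_mul !trmxK tr_flag_coord LE.
have cT t : (1%:M - E t) *m T' t = 1%:M - E t.
  rewrite mulmxBl mul1mx -cornerC cornerE /T' /corner.
  by rewrite addrAC subrr add0r.
have Lent a b : (rho a <= rho b)%N -> L a b = (a == b)%:R.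
  move=> ab.
  have : E (rho b).+1 *m L *m block_coord F rho (rho b) = block_coord F rho (rho b).
    rewrite /L -!mulmxA TB -{1}EB (mulmxA (invmx _)) (invKE _ (ltn_ord (rho b))) !mulmxA.
    rewrite -cornerE -!mulmxA (mulmxA (E _)) -(invKE _ (ltn_ord (rho b))) -mulmxA EB mulmxA.
    by rewrite mulmxV ?mul1mx //; apply: uK.
  move/matrixP/(_ a b); rewrite mul_mx_diag mul_diag_mx !mxE ltnS ab eqxx mulr1 mul1r => ->.
  by case: (eqVneq a b) => [->|]; rewrite ?eqxx ?mulr0n.
clearbody L T'.
have gramL t : flag_gram rho t L = (T' t)^T *m flag_gram rho t M *m T' t.
  rewrite /flag_gram (mulmxDr (T' t)^T) mulmxDl; congr (_ + _).
    by rewrite mulmxA LtE -!mulmxA LE !mulmxA.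
  rewrite -[RHS]mulmxA cT; apply: trmx_inj.
  by rewrite trmx_mul trmxK !linearB /= trmx1 tr_flag_coord cT.
have L0 : flag_denom rho L != 0.
  rewrite flag_denom_neq0; apply/forallP => t.
  have ts : (t <= s)%N by rewrite -ltnS.
  have := flag_gram_unit h0 ts; have := uT _ ts.
  rewrite !unitmxE !unitfE /flag_det gramL !det_mulmx det_tr => T0 N0.
  by rewrite !mulf_neq0.
have projL t : (t <= s)%N -> flag_proj rho t L = flag_proj rho t M.
  move=> ts; have uNL := flag_gram_unit L0 ts; have uN := flag_gram_unit h0 ts.
  rewrite /flag_proj -[LHS]mulmxA LtE LE.
  suff e : T' t *m invmx (flag_gram rho t L) *m (T' t)^T = invmx (flag_gram rho t M).
    by rewrite -e !mulmxA.
  have : (T' t)^T *m (flag_gram rho t M *m T' t *m invmx (flag_gram rho t L)) = 1%:M.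
    by rewrite !mulmxA -gramL mulmxV.
  move/mulmx1C => e; apply: (can_inj (mulKmx uN)).
  by rewrite mulmxV // -e !mulmxA.
exists L; split => //.
  rewrite /flag_point; apply: eq_bigr => t _.
  by rewrite (projL _ (ltn_ord t)) (projL _ (ltnW (ltn_ord t))).
Qed.

(** * The isospectral variety as a set *)

Section SpectralFrame.
Variables (F : fieldType) (n s : nat) (rho : 'I_n -> 'I_s) (x : 'I_s -> F).
Hypothesis F2 : 2%:R != 0 :> F.
Hypothesis x_inj : injective x.
Hypothesis trace_determines : forall e : 'I_n -> 'I_s,
  \sum_a x (e a) = \sum_a x (rho a) -> exists p : {perm 'I_n}, e =1 rho \o p.

(** An orthogonal eigenbasis realizes the eigenvalues in some order; the trace
    tells that this order is a permutation of the prescribed one. *)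
Lemma spectral_frame (X : 'M[F]_n) : X^T = X ->
  root_prod x X (enum 'I_s) = 0 -> \tr X = \sum_a x (rho a) ->
  exists (Q : 'M[F]_n) (g : 'rV[F]_n),
    [/\ Q^T *m Q = diag_mx g, forall a, g 0 a != 0 &
        X *m Q = Q *m block_scalar rho x].
Proof.
move=> Xs X0 trX; have [Q [g [e [QQ g0 XQ]]]] := orthogonal_eigenbasis F2 x_inj Xs X0.
have uQ : Q \in unitmx.
  have : \det (diag_mx g) != 0.
    by rewrite det_diag; apply/prodf_neq0 => a _; exact: g0.
  by rewrite -QQ det_mulmx det_tr mulf_eq0 orbb unitmxE unitfE.
have XE : X = Q *m diag_mx (\row_a x (e a)) *m invmx Q by rewrite -XQ mulmxK.
have [p ep] : exists p : {perm 'I_n}, e =1 rho \o p.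
  apply: trace_determines; rewrite -trX XE mxtrace_mulC mulKmx // mxtrace_diag.
  by apply: eq_bigr => a _; rewrite mxE.
pose q : {perm 'I_n} := (p^-1)%g.
have eq a : e (q a) = rho a by rewrite ep /= permKV.
exists (col_perm q Q), (col_perm q g); split.
- apply/matrixP => a b; have /matrixP /(_ (q a) (q b)) := QQ.
  rewrite !mxE (inj_eq perm_inj) => <-.
  by apply: eq_bigr => i _; rewrite !mxE.
- by move=> a; rewrite mxE.
- apply/matrixP => a b; have /matrixP /(_ a (q b)) := XQ.
  rewrite !mul_mx_diag !mxE eq => <-.
  by apply: eq_bigr => i _; rewrite !mxE.
Qed.

End SpectralFrame.

Section IsospectralPoints.
Variables (K : numClosedFieldType) (n s : nat) (rho : 'I_n -> 'I_s) (x : 'I_s -> K).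
Hypothesis x_inj : injective x.
Hypothesis trace_determines : forall e : 'I_n -> 'I_s,
  \sum_a x (e a) = \sum_a x (rho a) -> exists p : {perm 'I_n}, e =1 rho \o p.

Local Notation c := (\row_a x (rho a)).

(** Changing the sign of one column of Q does not affect the matrix. *)
Lemma isospectral_orthogonal (Q : 'M[K]_n) : Q^T *m Q = 1%:M ->
  isospectral_model c (Q *m block_scalar rho x *m Q^T).
Proof.
move=> QQ; case: (posnP n) => [n0|n_gt0].
  exists Q => //; split => //.
  by move: Q QQ; rewrite n0 => Q _; rewrite det_mx00.
pose a0 : 'I_n := Ordinal n_gt0.
pose D := diag_mx (\row_a if a == a0 then \det Q else 1).
have detQ2 : \det Q * \det Q = 1 by rewrite -[X in X * _]det_tr -det_mulmx QQ det1.
have DD : D *m D = 1%:M.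
  rewrite mulmx_diag; apply/matrixP => a b; rewrite !mxE.
  by case: ifP => _; rewrite ?detQ2 ?mulr1.
have Ds : D^T = D by rewrite tr_diag_mx.
exists (Q *m D); first split.
- by rewrite trmx_mul Ds mulmxA -(mulmxA D) QQ mulmx1.
- rewrite det_mulmx det_diag (bigD1 a0) //= big1 => [|a aa0]; rewrite !mxE ?eqxx ?mulr1 //.
  by rewrite (negPf aa0).
rewrite trmx_mul Ds -!mulmxA; congr (_ *m _); rewrite !mulmxA; congr (_ *m _).
by rewrite diag_mxC -mulmxA DD mulmx1.
Qed.

(** Over an algebraically closed field an orthogonal eigenbasis can be
    normalized to an orthonormal one. *)
Lemma isospectral_modelP (X : 'M[K]_n) : isospectral_model c X <->
  [/\ X^T = X, root_prod x X (enum 'I_s) = 0 & \tr X = \sum_a x (rho a)].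
Proof.
split=> [[Q [QQ _] <-]|[Xs X0 trX]].
  have QQ' : Q *m Q^T = 1%:M by apply: mulmx1C.
  have XQ : Q *m block_scalar rho x *m Q^T *m Q = Q *m block_scalar rho x.
    by rewrite -mulmxA QQ mulmx1.
  have g1 (a : 'I_n) : (const_mx 1 : 'rV[K]_n) 0 a != 0 by rewrite mxE oner_eq0.
  have QQ1 : Q^T *m Q = diag_mx (const_mx 1 : 'rV[K]_n) by rewrite diag_const_mx.
  have Q0 := flag_denom_orthogonal rho QQ1 g1.
  have <- := flag_point_frame QQ1 g1 XQ.
  split; [exact: tr_flag_point|exact: flag_point_roots|exact: mxtrace_flag_point].
have K2 : 2%:R != 0 :> K by rewrite Num.Theory.pnatr_eq0.
have [Q [g [QQ g0 XQ]]] := spectral_frame K2 x_inj trace_determines Xs X0 trX.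
have [r rr] : exists r : 'I_n -> K, forall a, r a * r a = g 0 a.
  by exists (fun a => sqrtC (g 0 a)) => a; rewrite -expr2 sqrtCK.
have r0 a : r a != 0 by have := g0 a; rewrite -rr mulf_eq0 orbb.
pose D := diag_mx (\row_a (r a)^-1).
have QQ1 : (Q *m D)^T *m (Q *m D) = 1%:M.
  rewrite trmx_mul tr_diag_mx mulmxA -(mulmxA _ Q^T) QQ !mulmx_diag.
  apply/matrixP => a b; rewrite !mxE; case: eqP => // _; rewrite !mulr1n.
  by rewrite -rr mulrA mulVf // mul1r mulfV.
have XQD : X *m (Q *m D) = (Q *m D) *m block_scalar rho x.
  by rewrite mulmxA XQ -!mulmxA diag_mxC.
have -> : X = (Q *m D) *m block_scalar rho x *m (Q *m D)^T.
  by rewrite -XQD -mulmxA (mulmx1C QQ1) mulmx1.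
exact: isospectral_orthogonal.
Qed.

Lemma isospectral_flag_point (M : 'M[K]_n) : flag_denom rho M != 0 ->
  isospectral_model c (flag_point rho x M).
Proof.
move=> M0; apply/isospectral_modelP.
split; [exact: tr_flag_point|exact: flag_point_roots|exact: mxtrace_flag_point].
Qed.

(** The Gram matrices of an orthogonal frame are trivial, so the parametrization
    by flags is defined there; hence it is onto. *)
Lemma isospectral_orthogonal_frame (X : 'M[K]_n) : isospectral_model c X ->
  exists Q : 'M[K]_n, [/\ Q^T *m Q = 1%:M, X = Q *m block_scalar rho x *m Q^T,
    flag_denom rho Q != 0 & flag_point rho x Q = X].
Proof.
move=> [Q [QQ _] <-]; exists Q.
have g1 (a : 'I_n) : (const_mx 1 : 'rV[K]_n) 0 a != 0 by rewrite mxE oner_eq0.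
have QQ1 : Q^T *m Q = diag_mx (const_mx 1 : 'rV[K]_n) by rewrite diag_const_mx.
split => //; first exact: flag_denom_orthogonal QQ1 g1.
by apply: (flag_point_frame QQ1 g1); rewrite -mulmxA QQ mulmx1.
Qed.

End IsospectralPoints.

(** * Coordinates of symmetric matrices *)

Section SymmetricCoordinates.
Variable n : nat.

Lemma upos_ofC (i j : 'I_n) : upos_of i j = upos_of j i.
Proof.
apply/val_inj => /=; case: (ltngtP i j) => // ij.
by have -> : i = j by apply/val_inj.
Qed.

Lemma upos_of_val (u : upos n) : upos_of (val u).1 (val u).2 = u.
Proof.
by apply/val_inj; case: u => -[i j] /= ij; rewrite [(i <= j)%N]ij.
Qed.

Definition upper_entry (T : Type) (M : 'M[T]_n) (k : 'I_(sdim n)) : T :=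
  M (val (enum_val k)).1 (val (enum_val k)).2.

Definition sym_matrix (T : Type) (p : 'rV[T]_(sdim n)) : 'M[T]_n :=
  \matrix_(i, j) p 0 (enum_rank (upos_of i j)).

Lemma tr_sym_matrix (T : Type) (p : 'rV[T]_(sdim n)) : (sym_matrix p)^T = sym_matrix p.
Proof. by apply/matrixP => i j; rewrite !mxE upos_ofC. Qed.

Variable K : fieldType.

Lemma tr_sym_var : (sym_var K n)^T = sym_var K n.
Proof. by apply/matrixP => i j; rewrite !mxE upos_ofC. Qed.

Lemma upper_entry_sym_var k : upper_entry (sym_var K n) k = 'X_k.
Proof. by rewrite /upper_entry mxE upos_of_val enum_valK. Qed.

Lemma sym_matrixK (p : 'rV[K]_(sdim n)) : sym_coord (sym_matrix p) = p.
Proof. by apply/rowP => k; rewrite !mxE upos_of_val enum_valK. Qed.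

Lemma sym_var_eval (p : 'rV[K]_(sdim n)) : map_mx (meval (p 0)) (sym_var K n) = sym_matrix p.
Proof. by apply/matrixP => i j; rewrite !mxE mevalXU. Qed.

Lemma sym_coordK (M : 'M[K]_n) : M^T = M -> sym_matrix (sym_coord M) = M.
Proof. by move=> Ms; rewrite -sym_var_eval sym_varK. Qed.

Lemma sym_coordE (M : 'M[K]_n) k : sym_coord M 0 k = upper_entry M k.
Proof. by rewrite mxE. Qed.

End SymmetricCoordinates.

Section GenericMatrix.
Variables (B : comNzRingType) (n : nat).

Definition generic_mx : 'M[{mpoly B[n * n]}]_n := \matrix_(i, j) 'X_(mxvec_index i j).

Definition mx_point (M : 'M[B]_n) : 'I_(n * n) -> B := mxvec M 0.

Lemma map_generic_mx (B' : comNzRingType) (i : {rmorphism B -> B'}) (M : 'M[B']_n) :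
  map_mx (mmap i (mxvec M 0)) generic_mx = M.
Proof. by apply/matrixP => a b; rewrite !mxE mmapX mmap1U mxvecE. Qed.

Lemma eval_generic_mx (M : 'M[B]_n) : map_mx (meval (mx_point M)) generic_mx = M.
Proof. by apply/matrixP => a b; rewrite !mxE mevalXU /mx_point mxvecE. Qed.

Lemma mx_point_surj (v : 'I_(n * n) -> B) : exists M, mx_point M =1 v.
Proof.
exists (vec_mx (\row_k v k)) => k; by rewrite /mx_point vec_mxK mxE.
Qed.

End GenericMatrix.

(** * The vanishing ideal *)

Section VanishingIdeal.
Variables (K : numClosedFieldType) (n s : nat) (rho : 'I_n -> 'I_s) (x : 'I_s -> K).
Hypothesis x_inj : injective x.
Hypothesis trace_determines : forall e : 'I_n -> 'I_s,
  \sum_a x (e a) = \sum_a x (rho a) -> exists p : {perm 'I_n}, e =1 rho \o p.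
Local Notation c := (\row_a x (rho a)).
Hypothesis values_x : distinct_values c = map x (enum 'I_s).

Local Notation Y := (isospectral_variety c).
Local Notation I := (isospectral_ideal c).
Local Notation X := (sym_var K n).
Implicit Types (f g : {mpoly K[sdim n]}) (p : 'rV[K]_(sdim n)).

Lemma natrS_neq0 k : k.+1%:R != 0 :> K.
Proof. by rewrite pnatr_eq0. Qed.

Lemma isospectral_varietyP p : Y p <-> isospectral_model c (sym_matrix p).
Proof.
split=> [[M cM <-]|cM].
  by have [Ms _ _] := (isospectral_modelP x_inj trace_determines M).1 cM; rewrite sym_coordK.
by exists (sym_matrix p); rewrite ?sym_matrixK.
Qed.

Lemma isospectral_varietyE p : Y p <->
  root_prod x (sym_matrix p) (enum 'I_s) = 0 /\ \tr (sym_matrix p) = \sum_a x (rho a).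
Proof.
rewrite isospectral_varietyP isospectral_modelP //.
by split=> [[]//|[? ?]]; split=> //; exact: tr_sym_matrix.
Qed.

Lemma min_poly_mxE : min_poly_mx c = root_prod (@mpolyC _ K \o x) X (enum 'I_s).
Proof. by rewrite /min_poly_mx values_x big_map. Qed.

Lemma sum_c : \sum_j c 0 j = \sum_a x (rho a).
Proof. by apply: eq_bigr => a _; rewrite mxE. Qed.

Lemma map_min_poly_mx (B : comNzRingType) (phi : {rmorphism {mpoly K[sdim n]} -> B}) :
  map_mx phi (min_poly_mx c) =
  root_prod (phi \o @mpolyC _ K \o x) (map_mx phi X) (enum 'I_s).
Proof. by rewrite min_poly_mxE map_root_prod. Qed.

Lemma zero_locus_ideal : zero_locus I = Y.
Proof.
apply/seteqP; split=> p.
  move=> pI; apply/isospectral_varietyE; rewrite -!sym_var_eval; split.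
    have := map_min_poly_mx (meval (p 0)).
    have -> : map_mx (meval (p 0)) (min_poly_mx c) = 0.
      apply/matrixP => i j; rewrite !mxE; apply: pI; apply: generated_ideal_gen.
      by left; exists i, j.
    move=> /esym; congr (_ = _); rewrite /root_prod; apply: eq_bigr => t _ /=.
    by rewrite mevalC.
  have : peval (\tr X - (\sum_(j < n) c 0 j)%:MP) p = 0.
    by apply: pI; apply: generated_ideal_gen; right.
  rewrite /peval mevalB mevalC sum_c => /eqP; rewrite subr_eq0 => /eqP <-.
  by rewrite trace_map_mx.
move=> /isospectral_varietyE [p0 ptr] _ [m [a [g [gG ->]]]].
rewrite /peval raddf_sum big1 // => i _ /=; rewrite mevalM.
suff -> : (g i).@[p 0] = 0 by rewrite mulr0.
case: (gG i) => [[k [l ->]]|->].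
  have /matrixP /(_ k l) := map_min_poly_mx (meval (p 0)).
  rewrite mxE => ->; rewrite sym_var_eval.
  have -> : root_prod (meval (p 0) \o @mpolyC _ K \o x) (sym_matrix p) (enum 'I_s) = 0.
    by rewrite -[RHS]p0 /root_prod; apply: eq_bigr => t _ /=; rewrite mevalC.
  by rewrite mxE.
by rewrite mevalB mevalC sum_c -ptr -sym_var_eval trace_map_mx subrr.
Qed.

Lemma ideal_sub_vanishing : I `<=` vanishing_ideal Y.
Proof. by move=> f If p; rewrite -zero_locus_ideal; apply. Qed.

Lemma variety_closed : zariski_closed Y.
Proof. by exists I; rewrite zero_locus_ideal. Qed.

Lemma base_point : Y (sym_coord (block_scalar rho x)).
Proof.
apply/isospectral_varietyP; rewrite sym_coordK ?tr_diag_mx //.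
have := @isospectral_orthogonal K n s rho x 1%:M.
by rewrite trmx1 !mulmx1 mul1mx; apply.
Qed.

(** The function f read on the parametrization of Y by frames, multiplied by a
    power of the denominator. *)
Definition frame_pullback k f : {mpoly K[n * n]} :=
  homog_eval k (@mpolyC _ K) f (flag_denom rho (generic_mx K n))
    (upper_entry (flag_num rho (@mpolyC _ K \o x) (generic_mx K n))).

Lemma frame_pullback_eval k f (M : 'M[K]_n) : (msize f <= k.+1)%N ->
  flag_denom rho M != 0 ->
  (frame_pullback k f).@[mx_point M] =
  flag_denom rho M ^+ k * peval f (sym_coord (flag_point rho x M)).
Proof.
move=> fk M0; rewrite /frame_pullback.
have denomE : (flag_denom rho (generic_mx K n)).@[mx_point M] = flag_denom rho M.
  by rewrite map_flag_denom eval_generic_mx.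
have numE k0 : (upper_entry (flag_num rho (@mpolyC _ K \o x) (generic_mx K n)) k0).@[mx_point M]
    = upper_entry (flag_num rho x M) k0.
  have /matrixP := map_flag_num (meval (mx_point M)) rho (@mpolyC _ K \o x) (generic_mx K n).
  rewrite eval_generic_mx => /(_ (val (enum_val k0)).1 (val (enum_val k0)).2).
  rewrite mxE => ->; congr (flag_num _ _ _ _ _); apply/funext => t /=.
  by rewrite mevalC.
rewrite (@homog_eval_rmorphism _ _ _ _ _ _ idfun (meval (mx_point M)) f _ _
  (flag_denom rho M) (upper_entry (flag_num rho x M))) //; last first.
  by move=> a /=; rewrite mevalC.
rewrite (@homog_evalE _ _ _ _ _ _ _ _ (sym_coord (flag_point rho x M) 0)) //.
move=> j; rewrite sym_coordE flag_num_field // /upper_entry.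
by rewrite mxE.
Qed.

Lemma generic_denom_neq0 : flag_denom rho (generic_mx K n) != 0.
Proof.
apply/eqP => h0.
have : (flag_denom rho (generic_mx K n)).@[mx_point 1%:M] = 0 by rewrite h0 meval0.
rewrite map_flag_denom eval_generic_mx => /eqP; apply/negP.
apply: (@flag_denom_orthogonal _ _ _ rho 1%:M (const_mx 1)).
  by rewrite trmx1 mulmx1 diag_const_mx.
by move=> a; rewrite mxE oner_eq0.
Qed.

Lemma frame_pullback_eq0 k f : (msize f <= k.+1)%N ->
  vanishing_ideal Y f <-> frame_pullback k f = 0.
Proof.
move=> fk; split=> [Yf|f0 p /isospectral_varietyP cp].
  have : frame_pullback k f * flag_denom rho (generic_mx K n) = 0.
    apply: (mpoly_nat_eq0 natrS_neq0) => v.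
    have [M Mv] := mx_point_surj (fun i => (v i)%:R : K).
    rewrite -(meval_eq _ Mv) mevalM map_flag_denom eval_generic_mx.
    have [->|M0] := eqVneq (flag_denom rho M) 0; first by rewrite mulr0.
    rewrite frame_pullback_eval // (Yf (sym_coord _)) ?mulr0 ?mul0r //.
    by exists (flag_point rho x M) => //; apply: isospectral_flag_point.
  by move/eqP; rewrite mulf_eq0 (negPf generic_denom_neq0) orbF => /eqP.
have [Q [QQ _ Q0 Qp]] := isospectral_orthogonal_frame cp.
have := frame_pullback_eval fk Q0; rewrite f0 meval0 Qp sym_matrixK => /esym/eqP.
by rewrite mulf_eq0 expf_eq0 (negPf Q0) andbF => /eqP.
Qed.

(** Pulling functions back to frames embeds the coordinate ring of Y in a
    polynomial ring, up to a nonzero denominator. *)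
Lemma vanishing_ideal_prime : prime_ideal (vanishing_ideal Y).
Proof.
split.
  apply/idealr_closedP; split.
  - by move=> p _; rewrite /peval meval0.
  - by move/(_ _ base_point)/eqP; rewrite /peval meval1 oner_eq0.
  - move=> a f g If Ig p Yp.
    by rewrite /peval mevalD mevalM [f.@[_]]If // [g.@[_]]Ig // mulr0 addr0.
move=> f g /set_mem Yfg; apply/orP.
pose k := maxn (msize f) (msize g).
have fk : (msize f <= k.+1)%N by apply: leqW; apply: leq_maxl.
have gk : (msize g <= k.+1)%N by apply: leqW; apply: leq_maxr.
have /eqP : frame_pullback k f * frame_pullback k g * flag_denom rho (generic_mx K n) = 0.
  apply: (mpoly_nat_eq0 natrS_neq0) => v.
  have [M Mv] := mx_point_surj (fun i => (v i)%:R : K).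
  rewrite -(meval_eq _ Mv) mevalM map_flag_denom eval_generic_mx.
  have [->|M0] := eqVneq (flag_denom rho M) 0; first by rewrite mulr0.
  rewrite mevalM !frame_pullback_eval // [_ * _ * (_ ^+ _ * _)]mulrACA.
  have : peval (f * g) (sym_coord (flag_point rho x M)) = 0.
    by apply: Yfg; exists (flag_point rho x M) => //; apply: isospectral_flag_point.
  by rewrite /peval mevalM => e; rewrite e mulr0 mul0r.
rewrite mulf_eq0 (negPf generic_denom_neq0) orbF mulf_eq0.
by case/orP => /eqP /frame_pullback_eq0 h; [left|right]; apply/mem_set/h.
Qed.

End VanishingIdeal.

(** * Generators of the vanishing ideal *)

Section Generators.
Variables (K : numClosedFieldType) (n s : nat) (rho : 'I_n -> 'I_s) (x : 'I_s -> K).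
Hypothesis x_inj : injective x.
Hypothesis trace_determines : forall e : 'I_n -> 'I_s,
  \sum_a x (e a) = \sum_a x (rho a) -> exists p : {perm 'I_n}, e =1 rho \o p.
Local Notation c := (\row_a x (rho a)).
Hypothesis values_x : distinct_values c = map x (enum 'I_s).
Local Notation Y := (isospectral_variety c).
Local Notation I := (isospectral_ideal c).
Local Notation X := (sym_var K n).

Section OverAlgebra.
Variables (A : comNzRingType) (pi : {rmorphism {mpoly K[sdim n]} -> A}).
Hypothesis piI : forall f, I f -> pi f = 0.
Let iota : {rmorphism K -> A} := pi \o @mpolyC _ K.
Let XA := map_mx pi X.

Lemma quotient_sym : XA^T = XA.
Proof. by rewrite /XA map_trmx tr_sym_var. Qed.

Lemma quotient_roots : root_prod (iota \o x) XA (enum 'I_s) = 0.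
Proof.
rewrite -(map_min_poly_mx values_x pi); apply/matrixP => i j; rewrite !mxE.
by apply: piI; apply: generated_ideal_gen; left; exists i, j.
Qed.

Lemma quotient_trace : \tr XA = \sum_a iota (x (rho a)).
Proof.
rewrite trace_map_mx -rmorph_sum; apply/eqP; rewrite -subr_eq0 /= -rmorphB /=.
by rewrite -(sum_c rho x) piI //; apply: generated_ideal_gen; right.
Qed.

Lemma iota_regular (t u : 'I_s) (b : A) :
  t != u -> (iota (x t) - iota (x u)) * b = 0 -> b = 0.
Proof.
move=> tu e; have d0 : x t - x u != 0.
  by rewrite subr_eq0; apply: contraNneq tu => /x_inj ->.
by rewrite -[b]mul1r -(rmorph1 iota) -(mulVf d0) rmorphM rmorphB /= -mulrA e mulr0.
Qed.

Lemma pi_mmap f : mmap iota (upper_entry XA) f = pi f.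
Proof.
have {2}-> : f = mmap (@mpolyC _ K) (fun i => 'X_i) f.
  rewrite {1}[f]mpolyE /mmap; apply: eq_bigr => m _.
  by rewrite mmap1_id mul_mpolyC.
rewrite (@mmap_rmorphism _ _ _ _ _ pi iota) //; congr (mmap _ _ _).
apply/funext => k /=; rewrite /upper_entry mxE -[pi _]/(pi (upper_entry X k)).
by rewrite upper_entry_sym_var.
Qed.

(** Substituting the frame [eigenframe X Q], whose flag is that of X, into the
    identity [frame_pullback k f = 0] recovers f(X), multiplied by a power of
    the denominator. *)
Lemma denom_annihilates f (Q : 'M[A]_n) : vanishing_ideal Y f ->
  exists k, flag_denom rho (eigenframe rho (iota \o x) XA Q) ^+ k * pi f = 0.
Proof.
move=> Yf; pose k := msize f; exists k.
have fk : (msize f <= k.+1)%N by apply: leqW.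
pose U := eigenframe rho (iota \o x) XA Q.
have XU := eigenframe_eigen rho Q quotient_roots.
have GE := eigenframe_orthogonal iota_regular _ quotient_sym XU.
have numU := flag_num_orthogonal GE XU.
pose sub := mmap iota (mxvec U 0).
have sub0 : sub (frame_pullback rho x k f) = 0.
  by rewrite (iffLR (frame_pullback_eq0 x_inj trace_determines fk)) // /sub raddf0.
rewrite -[RHS]sub0 /sub /frame_pullback.
rewrite (@homog_eval_rmorphism _ _ _ _ _ _ iota (mmap iota (mxvec U 0)) f _ _ (flag_denom rho U)
  (upper_entry (flag_num rho (iota \o x) U))).
- rewrite (@homog_evalE _ _ _ _ _ _ _ _ (upper_entry XA)) ?pi_mmap //.
  by move=> j; rewrite numU /upper_entry mxE.
- by move=> a /=; rewrite mmapC.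
- by rewrite map_flag_denom map_generic_mx.
move=> k0.
have /matrixP := map_flag_num (mmap iota (mxvec U 0)) rho (@mpolyC _ K \o x) (generic_mx K n).
rewrite map_generic_mx => /(_ (val (enum_val k0)).1 (val (enum_val k0)).2).
rewrite mxE /upper_entry => ->; congr (flag_num _ _ _ _ _); apply/funext => t /=.
by rewrite mmapC.
Qed.

End OverAlgebra.

(** The denominators attached to all constant frames Q generate the unit ideal
    modulo I: over a field, X has an orthogonal eigenbasis, so the denominator,
    as a polynomial in the entries of Q, is not zero. *)
Lemma denom_nonvanishing (F : fieldType) (pi : {rmorphism {mpoly K[sdim n]} -> F}) :
  (forall f, I f -> pi f = 0) ->
  exists N : 'M[nat]_n, flag_denom rho (eigenframe rho (pi \o @mpolyC _ K \o x)
    (map_mx pi X) (map_mx (fun k => k%:R) N)) != 0.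
Proof.
move=> piI; apply: contrapT => /forallNP denom0.
pose iota : {rmorphism K -> F} := pi \o @mpolyC _ K.
pose XF := map_mx pi X.
have F_char0 k : k.+1%:R != 0 :> F by rewrite -(rmorph_nat iota) fmorph_eq0 natrS_neq0.
have xF_inj : injective (iota \o x) by move=> t u /fmorph_inj /x_inj.
have traceF (e : 'I_n -> 'I_s) : \sum_a (iota \o x) (e a) = \sum_a (iota \o x) (rho a) ->
    exists p : {perm 'I_n}, e =1 rho \o p.
  by rewrite -!rmorph_sum => /fmorph_inj /trace_determines.
have [Q [g [QQ g0 XQ]]] := spectral_frame (F_char0 1%N) xF_inj traceF
  (quotient_sym pi) (quotient_roots piI) (quotient_trace piI).
(* The denominator is a polynomial P in the entries of the frame; it vanishes at
   all integral points, hence also at Q. *)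
pose mC := @mpolyC (n * n) F.
pose P := flag_denom rho (eigenframe rho (mC \o iota \o x) (map_mx mC XF) (generic_mx F n)).
have P_eval (M : 'M[F]_n) :
    P.@[mx_point M] = flag_denom rho (eigenframe rho (iota \o x) XF M).
  have xE : meval (mx_point M) \o (mC \o iota \o x) = iota \o x.
    by apply/funext => t /=; rewrite mevalC.
  have XE : map_mx (meval (mx_point M)) (map_mx mC XF) = XF.
    by rewrite -map_mx_comp; apply/matrixP => i j; rewrite [LHS]mxE /= mevalC.
  by rewrite map_flag_denom map_eigenframe eval_generic_mx xE XE.
have P0 : P = 0.
  apply: (mpoly_nat_eq0 F_char0) => v.
  have := denom0 (vec_mx (\row_k v k)) => /negP/negPn/eqP <-.
  rewrite -P_eval; apply: meval_eq => k.
  case/mxvec_indexP: k => i j.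
  by rewrite /mx_point mxvecE !mxE.
have := flag_denom_eigenframe xF_inj QQ g0 XQ.
by rewrite -P_eval P0 meval0 eqxx.
Qed.

(** The annihilator of f modulo I contains a power of every denominator, so no
    morphism to a field kills it, and it is the unit ideal. *)
Lemma vanishing_idealE : vanishing_ideal Y = I.
Proof.
apply/seteqP; split; last exact: ideal_sub_vanishing.
have I1 : ~ I 1.
  move=> /(ideal_sub_vanishing x_inj trace_determines values_x).
  move=> /(_ _ (base_point x_inj trace_determines)) /eqP.
  by rewrite /peval meval1 oner_eq0.
have [A [pi [pi0 _]]] := quotient_morphism (generated_ideal_closed I1).
have piI f : I f -> pi f = 0 by move/pi0.
move=> f Yf; apply/pi0.
(* J is the annihilator of f modulo the ideal. *)
pose J : set A := [set a | a * pi f = 0].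
have [|J1] := pselect (J 1); first by rewrite /J /= mul1r.
have [|F [phi phiJ]] := @morphism_to_field A J.
  apply/idealr_closedP; split=> //; first by rewrite /J /= mul0r.
  by move=> a u v; rewrite /J /= => uf vf; rewrite mulrDl -mulrA uf vf mulr0 addr0.
have phipiI g : I g -> (phi \o pi) g = 0 by move=> /piI /= ->; rewrite rmorph0.
have [N] := denom_nonvanishing phipiI.
have [k /phiJ] := denom_annihilates piI (map_mx (fun k => k%:R) N) Yf.
rewrite rmorphXn => /eqP; rewrite expf_eq0 => /andP [_].
rewrite map_flag_denom map_eigenframe -!map_mx_comp.
have -> : map_mx (phi \o (fun k => k%:R)) N = map_mx (fun k => k%:R) N.
  by apply/matrixP => i j; rewrite !mxE /= rmorph_nat.
by move=> ->.
Qed.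

End Generators.

(** * Tangent spaces *)

Section DividedDifference.
Variables (K : fieldType) (s : nat) (x : 'I_s -> K).
Implicit Types (r : seq 'I_s) (u v : K).

(** The divided difference of the polynomial with roots x t, t in r. *)
Fixpoint divdiff r u v : K :=
  if r is t :: r' then (u - x t) * divdiff r' u v + \prod_(i <- r') (v - x i) else 0.

Lemma divdiffE r u v :
  (u - v) * divdiff r u v = \prod_(i <- r) (u - x i) - \prod_(i <- r) (v - x i).
Proof.
elim: r => [|t r IH] /=; first by rewrite !big_nil mulr0 subrr.
by rewrite mulrDr mulrCA IH !big_cons; ring.
Qed.

Lemma divdiff_diag r t : injective x -> uniq r -> t \in r ->
  divdiff r (x t) (x t) != 0.
Proof.
move=> x_inj; elim: r => //= u r IH /andP [ur r_uniq]; rewrite inE => /predU1P [->|tr].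
  rewrite subrr mul0r add0r prodf_seq_neq0; apply/allP => i ir /=.
  by rewrite subr_eq0; apply: contraNneq ur => /x_inj ->.
rewrite (big_rem t tr) /= subrr mul0r addr0 mulf_neq0 ?IH // subr_eq0.
by apply: contraNneq ur => /x_inj <-.
Qed.

End DividedDifference.

Section LinearCoefficient.
Variables (K : fieldType) (n s : nat) (rho : 'I_n -> 'I_s) (x : 'I_s -> K).

Lemma root_prod_conj (B : comNzRingType) (y : 'I_s -> B) (Q Z : 'M[B]_n) r :
  Q *m Q^T = 1%:M -> root_prod y (Q^T *m Z *m Q) r = Q^T *m root_prod y Z r *m Q.
Proof.
move=> QQ; have QQ' := mulmx1C QQ.
elim: r => [|t r IH]; first by rewrite /root_prod !big_nil mulmx1 QQ'.
rewrite !root_prod_cons IH; have -> : Q^T *m Z *m Q - (y t)%:M = Q^T *m (Z - (y t)%:M) *m Q.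
  by rewrite mulmxBr mulmxBl mul_mx_scalar -scalemxAl QQ' scale_scalar_mx mulr1.
by rewrite !mulmxA -(mulmxA _ Q) QQ mulmx1.
Qed.

Lemma coef0_root_prod (W : 'M[K]_n) r a b :
  (root_prod (polyC \o x) (map_mx polyC (block_scalar rho x) + 'X *: map_mx polyC W) r a b)`_0
  = (\prod_(t <- r) (x (rho b) - x t)) *+ (a == b).
Proof.
elim: r a b => [|t r IH] a b.
  rewrite /root_prod !big_nil mxE coefMn coefC eqxx.
  by case: eqP.
rewrite root_prod_cons mxE coef_sum (bigD1 a) //= big1 ?addr0.
  rewrite !mxE eqxx coef0M IH !coefB coefD coefXM coefMn !coefC /= addr0.
  rewrite big_cons; case: (eqVneq a b) => [->|_]; rewrite ?mulr0 //.
move=> l la; rewrite !mxE eq_sym (negPf la) coef0M coefB coefD coefXM coefMn !coefC /=.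
by rewrite !mulr0n addr0 subr0 mul0r.
Qed.

(** The derivative of a polynomial of matrices at a diagonal matrix acts on each
    entry by a divided difference. *)
Lemma coef1_root_prod (W : 'M[K]_n) r a b :
  (root_prod (polyC \o x) (map_mx polyC (block_scalar rho x) + 'X *: map_mx polyC W) r a b)`_1
  = W a b * divdiff x r (x (rho a)) (x (rho b)).
Proof.
elim: r a b => [|t r IH] a b.
  rewrite /root_prod !big_nil mxE coefMn coefC /= mulr0.
  by rewrite mul0rn.
rewrite root_prod_cons mxE coef_sum.
under eq_bigr => l _ do
  rewrite coefM big_ord_recl big_ord1 /= subn0 /bump /= subnn IH coef0_root_prod.
rewrite big_split /= (bigD1 a) //= [X in _ + X + _]big1 ?addr0; last first.
  move=> l la; rewrite !mxE eq_sym (negPf la) coefB coefD coefXM coefMn !coefC /=.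
  by rewrite !mulr0n addr0 subr0 mul0r.
rewrite [X in _ + X](bigD1 b) //= [X in _ + (_ + X)]big1 ?addr0; last first.
  by move=> l lb; rewrite (negPf lb) mulr0n mulr0.
rewrite !mxE !eqxx !coefB !coefD !coefXM !coefMn !coefC /= !mulr1n.
by case: (a == b); rewrite /= ?mulr0n ?mulr1n ?mul0rn; ring.
Qed.

End LinearCoefficient.

(** * Smoothness *)

Section Tangent.
Variables (K : numClosedFieldType) (n s : nat) (rho : 'I_n -> 'I_s) (x : 'I_s -> K).
Hypothesis x_inj : injective x.
Hypothesis trace_determines : forall e : 'I_n -> 'I_s,
  \sum_a x (e a) = \sum_a x (rho a) -> exists p : {perm 'I_n}, e =1 rho \o p.
Local Notation c := (\row_a x (rho a)).
Hypothesis values_x : distinct_values c = map x (enum 'I_s).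
Local Notation Y := (isospectral_variety c).
Local Notation I := (isospectral_ideal c).
Local Notation X := (sym_var K n).
Implicit Types (f g : {mpoly K[sdim n]}) (p v : 'rV[K]_(sdim n)).

Lemma tangent_spaceP p v : tangent_space Y p v <->
  forall f, I f -> (on_line (p 0) (v 0) f)`_1 = 0.
Proof.
rewrite -(vanishing_idealE x_inj trace_determines values_x).
by split=> h f /h; rewrite on_line1.
Qed.

Lemma line_sym_var p v : map_mx (on_line (p 0) (v 0)) X =
  map_mx polyC (sym_matrix p) + 'X *: map_mx polyC (sym_matrix v).
Proof.
apply/matrixP => i j; rewrite !mxE /on_line mmapX mmap1U.
by rewrite -mul_polyC mulrC.
Qed.

Section AtFrame.
Variables (p : 'rV[K]_(sdim n)) (Q : 'M[K]_n).
Hypothesis QQ : Q^T *m Q = 1%:M.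
Hypothesis pQ : sym_matrix p = Q *m block_scalar rho x *m Q^T.

Lemma frame_in_variety : Y p.
Proof.
by apply/(isospectral_varietyP x_inj trace_determines); rewrite pQ; apply: isospectral_orthogonal.
Qed.

Lemma line_min_poly v : exists R : 'M[{poly K}]_n,
  map_mx (on_line (p 0) (v 0)) (min_poly_mx c) = map_mx polyC Q *m R *m (map_mx polyC Q)^T /\
  forall a b, (R a b)`_1 = (Q^T *m sym_matrix v *m Q) a b *
    divdiff x (enum 'I_s) (x (rho a)) (x (rho b)).
Proof.
pose W := Q^T *m sym_matrix v *m Q; pose q := map_mx polyC Q.
have qq : q *m q^T = 1%:M by rewrite map_trmx -map_mxM (mulmx1C QQ) map_mx1.
exists (root_prod (polyC \o x) (map_mx polyC (block_scalar rho x) + 'X *: map_mx polyC W) (enum 'I_s)).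
split; last by move=> a b; rewrite coef1_root_prod.
rewrite (map_min_poly_mx values_x) line_sym_var.
have -> : on_line (p 0) (v 0) \o @mpolyC _ K \o x = polyC \o x.
  by apply/funext => t /=; rewrite /on_line mmapC.
have -> : map_mx polyC (block_scalar rho x) + 'X *: map_mx polyC W =
    q^T *m (map_mx polyC (sym_matrix p) + 'X *: map_mx polyC (sym_matrix v)) *m q.
  rewrite mulmxDr mulmxDl -scalemxAr -scalemxAl /q map_trmx -!map_mxM; congr (map_mx _ _ + _).
  by rewrite pQ !mulmxA QQ mul1mx -mulmxA QQ mulmx1.
rewrite root_prod_conj // -/q.
by rewrite !mulmxA qq mul1mx -mulmxA qq mulmx1.
Qed.

(** The divided difference of the product of the T - x_t at two of its roots is
    nonzero when they are equal and zero otherwise, so the linearized equations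
    say exactly that the diagonal blocks vanish; the trace equation follows. *)
Lemma tangent_spaceE v : tangent_space Y p v <->
  forall a b, rho a = rho b -> (Q^T *m sym_matrix v *m Q) a b = 0.
Proof.
have QQ' := mulmx1C QQ; have [R [RE R1]] := line_min_poly v.
pose Rc := map_mx (coefp 1) R.
have coefM1 (Z : 'M[K]_n) (S : 'M[{poly K}]_n) :
    map_mx (coefp 1) (map_mx polyC Z *m S) = Z *m map_mx (coefp 1) S.
  apply/matrixP => i j; rewrite !mxE /= coef_sum; apply: eq_bigr => k _.
  by rewrite !mxE coefCM.
have coefM1r (Z : 'M[K]_n) (S : 'M[{poly K}]_n) :
    map_mx (coefp 1) (S *m map_mx polyC Z) = map_mx (coefp 1) S *m Z.
  apply/matrixP => i j; rewrite !mxE /= coef_sum; apply: eq_bigr => k _.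
  by rewrite !mxE coefMC.
have lin1 : map_mx (coefp 1) (map_mx (on_line (p 0) (v 0)) (min_poly_mx c)) = Q *m Rc *m Q^T.
  by rewrite RE map_trmx coefM1r coefM1.
split=> [/tangent_spaceP vI a b ab|W0].
  have : Rc = 0.
    have lin0 : map_mx (coefp 1) (map_mx (on_line (p 0) (v 0)) (min_poly_mx c)) = 0.
      apply/matrixP => i j; rewrite !mxE; apply: vI; apply: generated_ideal_gen.
      by left; exists i, j.
    have : Q^T *m (Q *m Rc *m Q^T) *m Q = 0 by rewrite -lin1 lin0 mulmx0 mul0mx.
    by rewrite !mulmxA QQ mul1mx -mulmxA QQ mulmx1.
  move/matrixP/(_ a b); rewrite [Rc _ _]mxE [X in _ = X -> _]mxE /= R1 ab => /eqP; rewrite mulf_eq0.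
  by rewrite (negPf (divdiff_diag _ _ _)) ?enum_uniq ?mem_enum // orbF => /eqP.
have Rc0 : Rc = 0.
  apply/matrixP => a b; rewrite !mxE /= R1.
  have [/W0 ->|ab] := eqVneq (rho a) (rho b); first by rewrite mul0r.
  have d0 : x (rho a) - x (rho b) != 0 by rewrite subr_eq0; apply: contraNneq ab => /x_inj ->.
  apply/eqP; rewrite mulf_eq0; apply/orP; right.
  have prod0 t : \prod_(i <- enum 'I_s) (x t - x i) = 0.
    by rewrite (big_rem t) ?mem_enum //= subrr mul0r.
  have /eqP := divdiffE x (enum 'I_s) (x (rho a)) (x (rho b)).
  by rewrite !prod0 subrr mulf_eq0 (negPf d0).
have p_zero f : I f -> f.@[p 0] = 0.
  by move=> If; apply: (ideal_sub_vanishing x_inj trace_determines values_x If); exact: frame_in_variety.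
apply/tangent_spaceP => _ [m [a [g [gG ->]]]].
rewrite raddf_sum coef_sum big1 // => i _ /=.
rewrite rmorphM coefM big_ord_recl big_ord1 /= subn0 /bump /= subnn !on_line0.
rewrite (p_zero (g i)) ?mulr0 ?addr0; last exact: generated_ideal_gen.
suff -> : (on_line (p 0) (v 0) (g i))`_1 = 0 by rewrite mulr0.
case: (gG i) => [[k [l ->]]|->].
  by have /matrixP /(_ k l) := lin1; rewrite Rc0 mulmx0 mul0mx !mxE /= => ->.
have onC e : on_line (p 0) (v 0) e%:MP = e%:P by rewrite /on_line mmapC.
rewrite rmorphB /= coefB onC coefC subr0 -trace_map_mx line_sym_var.
rewrite mxtraceD mxtraceZ !trace_map_mx coefD coefC coefXM coefC add0r /=.
have -> : \tr (sym_matrix v) = \tr (Q^T *m sym_matrix v *m Q).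
  by rewrite mxtrace_mulC mulmxA QQ' mul1mx.
by rewrite /mxtrace big1 // => j _; exact: W0.
Qed.

End AtFrame.

(** One pair for each coordinate of the tangent space: positions strictly above
    the diagonal blocks when indices are ordered by rho. *)
Definition block_pair : pred ('I_n * 'I_n) := fun ab => (rho ab.1 < rho ab.2)%N.
Local Notation d := #|block_pair|.
Definition pair_row (k : 'I_d) : 'I_n := (enum_val k).1.
Definition pair_col (k : 'I_d) : 'I_n := (enum_val k).2.

Lemma pair_lt k : (rho (pair_row k) < rho (pair_col k))%N.
Proof. exact: (enum_valP k). Qed.

Lemma pair_inj k l : pair_row k = pair_row l -> pair_col k = pair_col l -> k = l.
Proof.
move=> e1 e2; apply: enum_val_inj.
by rewrite [LHS]surjective_pairing [RHS]surjective_pairing; congr pair.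
Qed.

Lemma pair_surj a b : (rho a < rho b)%N -> exists k, pair_row k = a /\ pair_col k = b.
Proof.
move=> ab; have abP : (a, b) \in block_pair by [].
exists (enum_rank_in abP (a, b)).
by rewrite /pair_row /pair_col enum_rankK_in.
Qed.

(** Symmetric matrices that vanish on the diagonal blocks. *)
Definition off_block (u : 'I_d -> K) : 'M[K]_n :=
  \sum_k u k *: (delta_mx (pair_row k) (pair_col k) + delta_mx (pair_col k) (pair_row k)).

Lemma tr_off_block (u : 'I_d -> K) : (off_block u)^T = off_block u.
Proof.
rewrite /off_block raddf_sum; apply: eq_bigr => k _ /=.
by rewrite linearZ /= linearD /= !trmx_delta addrC.
Qed.

Lemma off_blockE (u : 'I_d -> K) k : off_block u (pair_row k) (pair_col k) = u k.
Proof.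
rewrite /off_block summxE (bigD1 k) //= big1 ?addr0 => [|l lk]; rewrite !mxE.
  rewrite !eqxx; have -> : (pair_row k == pair_col k) = false.
    by apply/eqP => e; have := pair_lt k; rewrite e ltnn.
  by rewrite addr0 mulr1.
have [e1|_] := eqVneq (pair_row k) (pair_row l).
  have [e2|_] := eqVneq (pair_col k) (pair_col l).
    by case/eqP: lk; apply/esym/pair_inj.
  have [e3|_] := eqVneq (pair_row k) (pair_col l); last by rewrite addr0 mulr0.
  by have := pair_lt l; rewrite -e1 -e3 ltnn.
have [e3|_] := eqVneq (pair_row k) (pair_col l); last by rewrite addr0 mulr0.
have [e4|_] := eqVneq (pair_col k) (pair_row l); last by rewrite addr0 mulr0.
by have := ltn_trans (pair_lt k) (eq_ind_r (fun i => (rho i < _)%N) (pair_lt l) e4); rewrite -e3 ltnn.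
Qed.

Lemma off_block0 (u : 'I_d -> K) a b : rho a = rho b -> off_block u a b = 0.
Proof.
move=> ab; rewrite /off_block summxE big1 // => k _; rewrite !mxE.
have klt := pair_lt k.
have [e1|_] := eqVneq a (pair_row k).
  have [e2|_] := eqVneq b (pair_col k); first by move: klt; rewrite -e1 -e2 ab ltnn.
  have [e3|_] := eqVneq a (pair_col k); last by rewrite addr0 mulr0.
  by move: klt; rewrite -e1 -e3 ltnn.
have [e3|_] := eqVneq a (pair_col k); last by rewrite addr0 mulr0.
have [e4|_] := eqVneq b (pair_row k); last by rewrite addr0 mulr0.
by move: klt; rewrite -e3 -e4 ab ltnn.
Qed.

Lemma off_block_surj (W : 'M[K]_n) : W^T = W ->
  (forall a b, rho a = rho b -> W a b = 0) ->
  W = off_block (fun k => W (pair_row k) (pair_col k)).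
Proof.
move=> Ws W0; set u := fun k => _; apply/matrixP => a b.
have [ab|ba|ab] := ltngtP (rho a) (rho b).
- by have [k [<- <-]] := pair_surj ab; rewrite off_blockE.
- have [k [<- <-]] := pair_surj ba.
  by rewrite -[in LHS]Ws -(tr_off_block u) mxE [RHS]mxE off_blockE.
- have e : rho a = rho b by apply: ord_inj.
  by rewrite W0 // off_block0.
Qed.

Lemma tangent_dimension p : Y p -> subspace_has_dim (tangent_space Y p) d.
Proof.
move=> /(isospectral_varietyP x_inj trace_determines) cp.
have [Q [QQ pQ _ _]] := isospectral_orthogonal_frame cp.
have QQ' := mulmx1C QQ.
pose B : 'M[K]_(d, sdim n) := \matrix_k sym_coord (Q *m
   (delta_mx (pair_row k) (pair_col k) + delta_mx (pair_col k) (pair_row k)) *m Q^T).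
have BE (u : 'rV[K]_d) : u *m B = sym_coord (Q *m off_block (u 0) *m Q^T).
  rewrite mulmx_sum_row /off_block mulmx_sumr mulmx_suml.
  have sumE (F : 'I_d -> 'M[K]_n) : sym_coord (\sum_k F k) = \sum_k sym_coord (F k).
    by apply/rowP => j; rewrite mxE !summxE; apply: eq_bigr => k _; rewrite mxE.
  rewrite sumE; apply: eq_bigr => k _; rewrite rowK -scalemxAr -scalemxAl.
  by apply/rowP => j; rewrite !mxE.
have symQ (W : 'M[K]_n) : W^T = W -> (Q *m W *m Q^T)^T = Q *m W *m Q^T.
  by move=> Ws; rewrite !trmx_mul trmxK Ws mulmxA.
exists B; split.
  rewrite -kermx_eq0; apply/rowV0P => u /sub_kermxP uB.
  have : sym_matrix (u *m B) = sym_matrix 0 by rewrite uB.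
  rewrite BE sym_coordK ?symQ ?tr_off_block // => e.
  have {}e : off_block (u 0) = 0.
    have -> : off_block (u 0) = Q^T *m (Q *m off_block (u 0) *m Q^T) *m Q.
      by rewrite !mulmxA QQ mul1mx -mulmxA QQ mulmx1.
    rewrite e; suff -> : sym_matrix (0 : 'rV[K]_(sdim n)) = 0 by rewrite mulmx0 mul0mx.
    by apply/matrixP => i j; rewrite !mxE.
  by apply/rowP => k; rewrite -off_blockE e !mxE.
apply/seteqP; split=> v.
  move=> /(tangent_spaceE QQ pQ) W0; apply/submxP.
  pose W := Q^T *m sym_matrix v *m Q.
  exists (\row_k W (pair_row k) (pair_col k)); rewrite BE.
  have Ws : W^T = W by rewrite /W !trmx_mul trmxK tr_sym_matrix mulmxA.
  have -> : off_block ((\row_k W (pair_row k) (pair_col k)) 0) = W.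
    rewrite [RHS](off_block_surj Ws W0); apply: eq_bigr => k _.
    by rewrite mxE.
  by rewrite /W !mulmxA QQ' mul1mx -mulmxA QQ' mulmx1 sym_matrixK.
move=> /submxP [u ->]; apply/(tangent_spaceE QQ pQ) => a b ab.
rewrite BE sym_coordK ?symQ ?tr_off_block //.
by rewrite !mulmxA QQ mul1mx -mulmxA QQ mulmx1 off_block0.
Qed.

Lemma variety_irreducible : irreducible_set Y.
Proof.
split; first by exists (sym_coord (block_scalar rho x)); apply: base_point.
move=> _ _ [S ->] [T ->] YST; apply: contrapT => /not_orP [YS YT].
have separate (S' : set {mpoly K[sdim n]}) : ~ Y `<=` zero_locus S' ->
    exists2 f, S' f & ~ vanishing_ideal Y f.
  move=> YS'; apply: contrapT => nf; apply: YS' => p Yp f S'f.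
  by apply: contrapT => fp; apply: nf; exists f => // /(_ p Yp).
have [f Sf Yf] := separate _ YS; have [g Tg Yg] := separate _ YT.
have [_ Yprime] := vanishing_ideal_prime x_inj trace_determines.
have /Yprime : f * g \in vanishing_ideal Y.
  apply/mem_set => p Yp; rewrite /peval mevalM.
  by case: (YST p Yp) => [/(_ f Sf)|/(_ g Tg)]; rewrite /peval => ->; rewrite ?mul0r ?mulr0.
by case/orP => /set_mem.
Qed.

Lemma variety_prime f g : vanishing_ideal Y (f * g) -> ~ vanishing_ideal Y f ->
  vanishing_ideal Y g.
Proof.
have [_ Yprime] := vanishing_ideal_prime x_inj trace_determines.
by move=> /mem_set /Yprime /orP [] /set_mem.
Qed.

Definition off_block_entries : d.-tuple {mpoly K[sdim n]} :=
  [tuple X (pair_row k) (pair_col k) | k < d].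

Lemma line_off_block (P : {mpoly K[d]}) p v : on_line (p 0) (v 0) (P \mPo off_block_entries) =
  on_line (fun k => sym_matrix p (pair_row k) (pair_col k))
          (fun k => sym_matrix v (pair_row k) (pair_col k)) P.
Proof.
have onC e : on_line (p 0) (v 0) e%:MP = e%:P by rewrite /on_line mmapC.
rewrite /comp_mpoly (@mmap_rmorphism _ _ _ _ _ (on_line (p 0) (v 0)) polyC) //.
congr (mmap _ _ _); apply/funext => k /=.
by rewrite tnth_mktuple !mxE /on_line mmapX mmap1U.
Qed.

Definition rotation (l : 'I_d) : 'M[K]_n :=
  delta_mx (pair_row l) (pair_col l) - delta_mx (pair_col l) (pair_row l).

Lemma tr_rotation l : (rotation l)^T = - rotation l.
Proof. by rewrite /rotation linearB /= !trmx_delta opprB. Qed.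

(** The commutator is the derivative at Z of the conjugation by the one-parameter
    group that S generates. *)
Definition velocity (B : comNzRingType) (S Z : 'M[B]_n) : 'M[B]_n := Z *m S - S *m Z.

Lemma velocity_block S a b :
  velocity S (block_scalar rho x) a b = (x (rho a) - x (rho b)) * S a b.
Proof. by rewrite /velocity mul_mx_diag mul_diag_mx !mxE; ring. Qed.

Lemma tr_velocity l p :
  (velocity (rotation l) (sym_matrix p))^T = velocity (rotation l) (sym_matrix p).
Proof.
by rewrite /velocity linearB /= !trmx_mul tr_rotation tr_sym_matrix mulmxN mulNmx opprK addrC.
Qed.

Lemma velocity_tangent p l : Y p ->
  tangent_space Y p (sym_coord (velocity (rotation l) (sym_matrix p))).
Proof.
move=> /(isospectral_varietyP x_inj trace_determines) cp.
have [Q [QQ pQ _ _]] := isospectral_orthogonal_frame cp.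
have QQ' := mulmx1C QQ.
apply/(tangent_spaceE QQ pQ) => a b ab.
rewrite sym_coordK ?tr_velocity //.
have -> : Q^T *m velocity (rotation l) (sym_matrix p) *m Q =
    block_scalar rho x *m (Q^T *m rotation l *m Q) - (Q^T *m rotation l *m Q) *m block_scalar rho x.
  rewrite /velocity mulmxBr mulmxBl pQ; congr (_ - _); first by rewrite !mulmxA QQ mul1mx.
  by rewrite -!mulmxA QQ mulmx1.
by rewrite -/(velocity _ _) velocity_block ab subrr mul0r.
Qed.

Definition velocity_mx (B : comNzRingType) (i : {rmorphism K -> B}) (Z : 'M[B]_n) : 'M[B]_d :=
  \matrix_(l, k) velocity (map_mx i (rotation l)) Z (pair_row k) (pair_col k).

Lemma map_velocity_mx (B B' : comNzRingType) (i : {rmorphism K -> B})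
    (i' : {rmorphism K -> B'}) (phi : {rmorphism B -> B'}) Z :
  (forall e, phi (i e) = i' e) ->
  map_mx phi (velocity_mx i Z) = velocity_mx i' (map_mx phi Z).
Proof.
move=> phii; apply/matrixP => l k; rewrite [RHS]mxE [LHS]mxE [velocity_mx _ _ _ _]mxE.
have -> : map_mx i' (rotation l) = map_mx phi (map_mx i (rotation l)).
  by apply/matrixP => a b; rewrite !mxE phii.
have map_vel (S T : 'M[B]_n) :
    velocity (map_mx phi S) (map_mx phi T) = map_mx phi (velocity S T).
  by rewrite /velocity map_mxB !map_mxM.
by rewrite map_vel [RHS]mxE.
Qed.

(** At diag(c) the velocity of a rotation in the plane of a and b has
    c_a - c_b as its only entry above the diagonal blocks. *)
Lemma velocity_base : \det (velocity_mx idfun (block_scalar rho x)) != 0.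
Proof.
have -> : velocity_mx idfun (block_scalar rho x) =
    diag_mx (\row_k (x (rho (pair_row k)) - x (rho (pair_col k)))).
  apply/matrixP => l k; rewrite [LHS]mxE velocity_block !mxE.
  have klt := pair_lt k; have llt := pair_lt l.
  have [<-|lk] := eqVneq l k.
    rewrite !eqxx; have -> : (pair_row l == pair_col l) = false.
      by apply/eqP => e; move: llt; rewrite e ltnn.
    by rewrite /= mulr1n subr0 mulr1.
  rewrite mulr0n; set a := pair_row k; set b := pair_col k.
  suff -> : ((a == pair_row l) && (b == pair_col l))%:R -
      ((a == pair_col l) && (b == pair_row l))%:R = 0 :> K by rewrite mulr0.
  have -> : (a == pair_row l) && (b == pair_col l) = false.
    by apply/negP => /andP [/eqP e1 /eqP e2]; case/eqP: lk; apply: pair_inj.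
  have -> : (a == pair_col l) && (b == pair_row l) = false; last by rewrite subrr.
  apply/negP => /andP [/eqP e1 /eqP e2].
  by have := ltn_trans klt; move=> /(_ (rho a)); rewrite -/a -/b e1 e2 => /(_ llt); rewrite ltnn.
rewrite det_diag; apply/prodf_neq0 => k _; rewrite mxE subr_eq0.
by apply/eqP => /x_inj e; have := pair_lt k; rewrite e ltnn.
Qed.

(** The velocities of rotations are tangent to Y and generically span its tangent
    spaces, so by the chain rule the gradient of a relation between the
    off-block entries vanishes where a determinant does not; primality of the
    vanishing ideal removes that restriction. *)
Lemma relation_derivative (P : {mpoly K[d]}) k :
  vanishing_ideal Y (P \mPo off_block_entries) ->
  vanishing_ideal Y (P^`M(k) \mPo off_block_entries).
Proof.
move=> YP; pose delta := \det (velocity_mx (@mpolyC _ K) X).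
have deltaE p : delta.@[p 0] = \det (velocity_mx idfun (sym_matrix p)).
  rewrite /delta -det_map_mx (@map_velocity_mx _ _ _ idfun) ?sym_var_eval //.
  by move=> e; rewrite /= mevalC.
apply: (@variety_prime delta).
  move=> p Yp; rewrite /peval mevalM deltaE.
  pose grad : 'cV[K]_d := \col_j (P^`M(j) \mPo off_block_entries).@[p 0].
  have : velocity_mx idfun (sym_matrix p) *m grad = 0.
    apply/matrixP => l z; rewrite !mxE.
    have := velocity_tangent l Yp (f := P \mPo off_block_entries) YP.
    rewrite -on_line1 line_off_block on_line1 sym_coordK ?tr_velocity // => e.
    apply: etrans e; apply: eq_bigr => j _.
    rewrite [velocity_mx _ _ _ _]mxE [grad _ _]mxE mulrC; congr (_ * _).
      rewrite comp_mpoly_meval; apply: meval_eq => i.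
      by rewrite tnth_mktuple -sym_var_eval !mxE.
    by have -> : map_mx idfun (rotation l) = rotation l by apply/matrixP => a b; rewrite mxE.
  (* Cramer's rule turns the linear system for the gradient into the claim. *)
  move/(congr1 (mulmx (\adj (velocity_mx idfun (sym_matrix p))))).
  rewrite mulmxA mul_adj_mx mulmx0 mul_scalar_mx => /matrixP /(_ k 0).
  by rewrite !mxE.
move=> /(_ _ (base_point x_inj trace_determines)); rewrite /peval deltaE.
rewrite sym_coordK ?tr_diag_mx // => /eqP; apply/negP; exact: velocity_base.
Qed.

(** Differentiating a nonzero relation by its leading monomial would leave a
    nonzero constant that vanishes on Y. *)
Lemma off_block_entries_independent : alg_independent_on Y off_block_entries.
Proof.
move=> P YP; apply: contrapT => /eqP P0.
have derivs m : vanishing_ideal Y (P^`M[m] \mPo off_block_entries).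
  rewrite (multinomUE_id m); elim: (index_enum _) => [|i r IH].
    by rewrite big_nil mderivm0m.
  rewrite big_cons addmC mderivmDm.
  elim: (m i) => [|e IHe]; first by rewrite mulm0n mderivm0m.
  by rewrite mulmSr mderivmDm mderivmU1m; apply: relation_derivative.
have := derivs (mlead P); set D := P^`M[mlead P].
have -> : D = (D@_0%MM)%:MP.
  apply/mpolyP => m; rewrite mcoeffC; case: eqP => [->|m0]; first by rewrite mulr1.
  rewrite mulr0 mcoeff_mderivm mcoeff_gt_mlead ?mul0rn //.
  have [/eqP|] := eqVneq m 0%MM; first by move/eqP/m0.
  move=> m1; have := ltmc_add2r (mlead P) 0%MM m; rewrite addm0 => ->.
  by rewrite Order.POrderTheory.lt_neqAle eq_sym m1 le0m.
rewrite comp_mpolyC => /(_ _ (base_point x_inj trace_determines)) /eqP.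
rewrite /peval mevalC mcoeff_mderivm addm0 -mulr_natr mulf_eq0.
rewrite mleadc_eq0 (negPf P0) pnatr_eq0 /=.
rewrite -leqn0 leqNgt prodn_gt0 // => i; rewrite ffact_gt0 //.
Qed.

(** Frames that are block unitriangular, with free entries below the diagonal
    blocks. *)
Definition echelon_frame : 'M[{mpoly K[d]}]_n :=
  1%:M + \sum_k 'X_k *: delta_mx (pair_col k) (pair_row k).

Lemma echelon_frame_eval (L : 'M[K]_n) :
  (forall a b, (rho a <= rho b)%N -> L a b = (a == b)%:R) ->
  map_mx (meval (fun k => L (pair_col k) (pair_row k))) echelon_frame = L.
Proof.
move=> L1; apply/matrixP => a b; rewrite !mxE summxE rmorphD rmorph_sum /=.
have term k : (('X_k *: delta_mx (pair_col k) (pair_row k) : 'M[{mpoly K[d]}]_n) a b).@[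
     fun k => L (pair_col k) (pair_row k)] =
     if (a == pair_col k) && (b == pair_row k) then L a b else 0.
  rewrite !mxE mevalM mevalXU rmorph_nat.
  by case: eqP => [->|_]; case: eqP => [->|_]; rewrite ?mulr1 ?mulr0.
rewrite (eq_bigr _ (fun k _ => term k)) rmorph_nat.
have [ab|ba] := leqP (rho a) (rho b).
  rewrite L1 // big1 ?addr0 // => k _; case: andP => // -[/eqP e1 /eqP e2].
  by move: ab; rewrite e1 e2 leqNgt pair_lt.
have [k [<- <-]] := pair_surj ba.
have -> : (pair_col k == pair_row k) = false.
  by apply/eqP => e; have := pair_lt k; rewrite e ltnn.
rewrite add0r (bigD1 k) //= !eqxx big1 ?addr0 // => l lk.
case: andP => // -[/eqP e1 /eqP e2]; case/eqP: lk; exact/esym/pair_inj.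
Qed.

(** A generic frame spans the same flag as some echelon frame, and a polynomial
    in the entries of a frame that vanishes generically is zero. *)
Lemma echelon_dense f :
  (forall L : 'M[K]_n, flag_denom rho L != 0 ->
     (forall a b, (rho a <= rho b)%N -> L a b = (a == b)%:R) ->
     peval f (sym_coord (flag_point rho x L)) = 0) ->
  vanishing_ideal Y f.
Proof.
move=> f0; have fk : (msize f <= (msize f).+1)%N by [].
apply/(frame_pullback_eq0 x_inj trace_determines fk).
have /eqP : frame_pullback rho x (msize f) f * reduction_denom rho (generic_mx K n) = 0.
  apply: (mpoly_nat_eq0 (@natrS_neq0 K)) => v.
  have [M Mv] := mx_point_surj (fun i => (v i)%:R : K).
  rewrite -(meval_eq _ Mv) mevalM map_reduction_denom eval_generic_mx.
  have [->|M0] := eqVneq (reduction_denom rho M) 0; first by rewrite mulr0.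
  have h0 : flag_denom rho M != 0.
    by move: M0; rewrite /reduction_denom !mulf_eq0 !negb_or => /andP [/andP [? ?] ?].
  have [L [L0 LM Lent]] := reduced_frame x M0.
  by rewrite frame_pullback_eval // -LM (f0 L) ?mulr0 ?mul0r.
rewrite mulf_eq0 => /orP [/eqP //|/eqP red0].
have : (reduction_denom rho (generic_mx K n)).@[mx_point 1%:M] = 0 by rewrite red0 meval0.
by rewrite map_reduction_denom eval_generic_mx reduction_denom1 => /eqP; rewrite oner_eq0.
Qed.

(** Restricted to echelon frames, the functions g become rational functions of d
    variables with a common denominator. *)
Lemma independent_size m (g : m.-tuple {mpoly K[sdim n]}) :
  alg_independent_on Y g -> (m <= d)%N.
Proof.
move=> g_indep; rewrite leqNgt; apply/negP => dm.
pose h := flag_denom rho echelon_frame.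
pose y := upper_entry (flag_num rho (@mpolyC _ K \o x) echelon_frame).
pose e := \max_j msize (tnth g j).
have ge j : (msize (tnth g j) <= e.+1)%N by apply: leqW; apply: leq_bigmax.
pose G j := homog_eval e (@mpolyC _ K) (tnth g j) h y.
have [P [k [P0 Pk PG]]] := rational_algebraic_dependence (h ^+ e) G dm.
case/eqP: P0; apply: g_indep; apply: echelon_dense => L L0 L1.
pose u k := L (pair_col k) (pair_row k).
pose z := sym_coord (flag_point rho x L).
have hE : h.@[u] = flag_denom rho L.
  by rewrite /h map_flag_denom echelon_frame_eval.
have xE : meval u \o (@mpolyC _ K \o x) = x by apply/funext => t /=; rewrite mevalC.
have yE i : (y i).@[u] = flag_denom rho L * z 0 i.
  have /matrixP := map_flag_num (meval u) rho (@mpolyC _ K \o x) echelon_frame.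
  rewrite echelon_frame_eval // xE flag_num_field //.
  move=> /(_ (val (enum_val i)).1 (val (enum_val i)).2); rewrite mxE => ->.
  by rewrite mxE /z sym_coordE.
have GE j : (G j).@[u] = flag_denom rho L ^+ e * (tnth g j).@[z 0].
  rewrite /G (@homog_eval_rmorphism _ _ _ _ _ _ idfun (meval u) _ _ _
    (flag_denom rho L) (fun i => flag_denom rho L * z 0 i)) //; last by move=> a /=; rewrite mevalC.
  exact: homog_evalE.
have : (homog_eval k (@mpolyC _ K) P (h ^+ e) G).@[u] = 0 by rewrite PG meval0.
rewrite (@homog_eval_rmorphism _ _ _ _ _ _ idfun (meval u) _ _ _
  (flag_denom rho L ^+ e) (fun j => flag_denom rho L ^+ e * (tnth g j).@[z 0])) //; first last.
- by rewrite rmorphXn /= hE.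
- by move=> a /=; rewrite mevalC.
rewrite (@homog_evalE _ _ _ _ _ _ _ _ (fun j => (tnth g j).@[z 0])) // => /eqP.
rewrite mulf_eq0 !expf_eq0 (negPf L0) !andbF /= => /eqP P0.
by rewrite /peval comp_mpoly_meval.
Qed.

Lemma isospectral_smooth : smooth_variety Y.
Proof.
split; first exact: variety_closed.
  exact: variety_irreducible.
exists d; last exact: tangent_dimension.
split; last exact: independent_size.
by exists off_block_entries; exact: off_block_entries_independent.
Qed.

End Tangent.

(** * Generic eigenvalues *)

Section TraceSeparated.
Variables (K : numClosedFieldType) (n : nat) (c : 'rV[K]_n).
Hypothesis trace_separates : forall u : 'I_n -> 'I_n,
  \sum_a c 0 (u a) = \sum_a c 0 a -> exists p : {perm 'I_n}, forall a, c 0 (u a) = c 0 (p a).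

(** Any c can be written as x o rho with x injective, by listing its distinct
    values. *)
Lemma isospectral_trace_separated :
  [/\ smooth_variety (isospectral_variety c),
      prime_ideal (vanishing_ideal (isospectral_variety c))
    & vanishing_ideal (isospectral_variety c) = isospectral_ideal c].
Proof.
pose dv := distinct_values c; pose s := size dv.
pose x (t : 'I_s) : K := nth 0 dv t.
have c_dv a : c 0 a \in dv by rewrite mem_undup codom_f.
have rho_lt a : (index (c 0 a)%R dv < s)%N by rewrite index_mem.
pose rho a : 'I_s := Ordinal (rho_lt a).
have x_rho a : x (rho a) = c 0 a by rewrite /x nth_index.
have x_inj : injective x.
  move=> t u /eqP; rewrite /x nth_uniq ?undup_uniq //; move/eqP; exact: ord_inj.
have cE : c = \row_a x (rho a) by apply/rowP => a; rewrite mxE x_rho.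
have values_x : distinct_values (\row_a x (rho a)) = map x (enum 'I_s).
  rewrite -cE -/dv -[LHS](mkseq_nth 0) /mkseq -/s -val_enum_ord -map_comp.
  exact: eq_map.
have traces (e : 'I_n -> 'I_s) : \sum_a x (e a) = \sum_a x (rho a) ->
    exists p : {perm 'I_n}, e =1 rho \o p.
  have cod t : exists a, x t = c 0 a.
    have : x t \in dv by rewrite mem_nth.
    by rewrite mem_undup => /codomP.
  move=> sum_e; pose u a := projT1 (cid (cod (e a))).
  have uE a : x (e a) = c 0 (u a) by rewrite /u; case: cid.
  have [|p pE] := @trace_separates u.
    by rewrite -(eq_bigr _ (fun a _ => uE a)) sum_e; apply: eq_bigr => a _.
  by exists p => a; apply: x_inj; rewrite uE pE x_rho.
rewrite cE; split.
- exact: isospectral_smooth.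
- exact: vanishing_ideal_prime.
- exact: vanishing_idealE.
Qed.

End TraceSeparated.

(** The number, from 0, of the block that contains the index a: it is the number
    of blocks that end at or before a. *)
Definition block_index (k : seq nat) (a : nat) : nat := count (fun v => (v <= a)%N) k.

Lemma nth_le_block_index k a i : sorted ltn k -> (i < size k)%N ->
  (nth 0 k i <= a)%N = (i < block_index k a)%N.
Proof.
elim: k i => //= v k IH i pk; have sk := path_sorted pk.
have [va|av] := leqP v a.
  by case: i => [|i]; rewrite ?va //= ltnS => /(IH _ sk) ->.
have -> : block_index k a = 0%N.
  apply/eqP; rewrite -leqn0 leqNgt -has_count; apply/hasPn => w wk.
  by rewrite -ltnNge (ltn_trans av) //; have /allP := order_path_min ltn_trans pk; apply.
case: i => [|i] /= ik; first by apply/negbTE; rewrite -ltnNge.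
apply/negbTE; rewrite -ltnNge (ltn_trans av) //.
have /allP := order_path_min ltn_trans pk; apply; exact: mem_nth.
Qed.

Section BlockSpace.
Variables (K : numClosedFieldType) (n r : nat) (k : r.-tuple nat).
Hypothesis k_incr : forall i j : 'I_r, (i < j)%N -> (tnth k i < tnth k j)%N.
Local Notation bl := (block_index k).
Local Notation kk := (nth 0%N (0%N :: rcons k n)).

Lemma sorted_k : sorted ltn k.
Proof.
apply/(sortedP 0%N) => i; rewrite size_tuple => ir.
by have := @k_incr (Ordinal (ltnW ir)) (Ordinal ir) (leqnn _); rewrite !(tnth_nth 0%N).
Qed.

Lemma block_boundS i : (i < r)%N -> kk i.+1 = nth 0%N k i.
Proof. by move=> ir; rewrite /= nth_rcons size_tuple ir. Qed.

Lemma block_bound_last : kk r.+1 = n.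
Proof. by rewrite /= nth_rcons size_tuple ltnn eqxx. Qed.

Lemma block_index_le a : (bl a <= r)%N.
Proof. by rewrite -[X in (_ <= X)%N](size_tuple k); apply: count_size. Qed.

Lemma block_indexP (j : 'I_r.+1) a : (a < n)%N ->
  (kk j <= a < kk j.+1)%N = (bl a == j).
Proof.
move=> an; have jr : (j <= r)%N by rewrite -ltnS.
have -> : (kk j <= a)%N = (j <= bl a)%N.
  case: (nat_of_ord j) jr => // i ir.
  by rewrite block_boundS // nth_le_block_index ?sorted_k ?size_tuple.
have -> : (a < kk j.+1)%N = (bl a <= j)%N.
  move: jr; rewrite leq_eqVlt => /predU1P [->|jr].
    by rewrite block_bound_last an block_index_le.
  rewrite block_boundS // ltnNge nth_le_block_index ?sorted_k ?size_tuple //.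
  by rewrite -leqNgt.
by rewrite andbC -eqn_leq.
Qed.

Lemma block_spaceP (c : 'rV[K]_n) : block_space K k n c <->
  forall a b : 'I_n, bl a = bl b -> c 0 a = c 0 b.
Proof.
split=> cB.
  move=> a b ab; have br : (bl a < r.+1)%N by rewrite ltnS block_index_le.
  by apply: (cB (Ordinal br)); rewrite block_indexP //= ab.
move=> j a b; rewrite !block_indexP // => /eqP aj /eqP bj.
by apply: cB; rewrite aj bj.
Qed.

Lemma perm_of_blocks (u : 'I_n -> 'I_n) :
  perm_eq [seq bl (u a) | a <- enum 'I_n] [seq bl a | a : 'I_n <- enum 'I_n] ->
  exists p : {perm 'I_n}, forall a, bl (u a) = bl (p a).
Proof.
move=> pu; have /tuple_permP [p pE] : perm_eq [tuple bl (u a) | a < n] [tuple bl a | a < n].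
  by [].
exists p => a; have := congr1 (fun s => nth 0%N s a) pE.
by rewrite -!tnth_nth !tnth_mktuple.
Qed.

(** The sum over the c (u a) then differs from the sum over the c a as a linear
    form on the block space. *)
Definition moves_blocks (u : {ffun 'I_n -> 'I_n}) :=
  ~~ perm_eq [seq bl (u a) | a <- enum 'I_n] [seq bl a | a : 'I_n <- enum 'I_n].

Definition trace_discriminant : {mpoly K[n]} :=
  \prod_(u | moves_blocks u) (\sum_a 'X_(u a) - \sum_a 'X_a).

Lemma trace_discriminant_eval (c : 'rV[K]_n) : peval trace_discriminant c =
  \prod_(u | moves_blocks u) (\sum_a c 0 (u a) - \sum_a c 0 a).
Proof.
rewrite /peval rmorph_prod; apply: eq_bigr => u _; rewrite rmorphB !rmorph_sum /=.
by congr (_ - _); apply: eq_bigr => a _; rewrite mevalXU.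
Qed.

Lemma trace_discriminant_separates (c : 'rV[K]_n) : block_space K k n c ->
  peval trace_discriminant c != 0 ->
  forall u : 'I_n -> 'I_n, \sum_a c 0 (u a) = \sum_a c 0 a ->
    exists p : {perm 'I_n}, forall a, c 0 (u a) = c 0 (p a).
Proof.
move=> /block_spaceP cB; rewrite trace_discriminant_eval => /prodf_neq0 c0 u uE.
have [|p pE] := @perm_of_blocks u; last by exists p => a; apply: cB.
apply: contraT => npu; have := c0 [ffun a => u a].
have fE a : [ffun a => u a] a = u a by rewrite ffunE.
have sE : [seq bl ([ffun a => u a] a) | a <- enum 'I_n] = [seq bl (u a) | a <- enum 'I_n].
  by apply: eq_map => a; rewrite fE.
rewrite /moves_blocks sE => /(_ npu).
rewrite (eq_bigr (fun a => c 0 (u a))) => [|a _]; last by rewrite fE.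
by rewrite uE subrr eqxx.
Qed.

(** Take the value t^j on block j.  The sums over the c (u a) and over the c a are
    then polynomials in t whose coefficients are the numbers of indices sent to
    each block, so they differ for all but finitely many t. *)
Lemma trace_discriminant_neq0 :
  exists2 c, block_space K k n c & peval trace_discriminant c != 0.
Proof.
pose pol (u : 'I_n -> 'I_n) : {poly K} := \sum_a 'X^(bl (u a)).
have pol_coef u j : (pol u)`_j = (count_mem j [seq bl (u a) | a <- enum 'I_n])%:R.
  rewrite /pol coef_sum count_map -sum1_count [in RHS]big_mkcond /= big_enum /= natr_sum.
  by apply: eq_bigr => a _; rewrite coefXn eq_sym; case: eqP.
(* P is the discriminant as a polynomial in t. *)
pose P := \prod_(u : {ffun 'I_n -> 'I_n} | moves_blocks u) (pol u - pol id).
have P0 : P != 0.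
  apply/prodf_neq0 => u; apply: contra; rewrite subr_eq0 => /eqP e.
  apply/allP => j _ /=; apply/eqP; apply: (natr_inj_char0 (@natrS_neq0 K)).
  by rewrite -(pol_coef u) e pol_coef.
have [t Pt] := poly_nat_nonroot (@natrS_neq0 K) P0.
exists (\row_a t%:R ^+ bl a); first by apply/block_spaceP => a b ab; rewrite !mxE ab.
rewrite trace_discriminant_eval; apply: contraNneq Pt => <-; apply/eqP.
rewrite /P horner_prod; apply: eq_bigr => u _; rewrite hornerD hornerN !horner_sum.
by congr (_ - _); apply: eq_bigr => a _; rewrite hornerXn mxE.
Qed.

Lemma generic_trace_separated : exists Z : set 'rV[K]_n,
  [/\ zariski_closed Z, Z `<` block_space K k n &
    forall c, (block_space K k n `\` Z) c -> forall u : 'I_n -> 'I_n,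
      \sum_a c 0 (u a) = \sum_a c 0 a ->
      exists p : {perm 'I_n}, forall a, c 0 (u a) = c 0 (p a)].
Proof.
pose S : set {mpoly K[n]} := [set f | f = trace_discriminant \/
  exists a b : 'I_n, bl a = bl b /\ f = 'X_a - 'X_b].
have S_block c : zero_locus S c -> block_space K k n c.
  move=> Sc; apply/block_spaceP => a b ab; apply/eqP; rewrite -subr_eq0.
  have /eqP : peval ('X_a - 'X_b) c = 0 by apply: Sc; right; exists a, b.
  by rewrite /peval mevalB !mevalXU.
exists (zero_locus S); split; first by exists S.
  split=> [c /S_block //|BS]; have [c /BS Sc] := trace_discriminant_neq0.
  by rewrite Sc ?eqxx //; left.
move=> c [Bc Sc]; apply: trace_discriminant_separates => //.
apply: contra_notN Sc => /eqP c0 f [->//|[a [b [ab ->]]]].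
by rewrite /peval mevalB !mevalXU ((block_spaceP c).1 Bc a b ab) subrr.
Qed.

End BlockSpace.

Local Open Scope complex_scope.

Theorem theorem2p9 (R : realType) (n r : nat) (k : r.-tuple nat)
    (r_gt0 : (0 < r)%N)
    (k_range : forall j : 'I_r, (1 <= tnth k j <= n)%N)
    (k_incr : forall i j : 'I_r, (i < j)%N -> (tnth k i < tnth k j)%N) :
  exists Z : set 'rV[R[i]]_n,
    [/\ zariski_closed Z, Z `<` block_space R[i] k n
      & forall c : 'rV[R[i]]_n, (block_space R[i] k n `\` Z) c ->
          [/\ smooth_variety (isospectral_variety c),
              prime_ideal (vanishing_ideal (isospectral_variety c))
            & vanishing_ideal (isospectral_variety c) = isospectral_ideal c]].
Proof.
have [Z [Zclosed Zproper Zgen]] := @generic_trace_separated R[i] n r k k_incr.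
exists Z; split => // c cZ; apply: isospectral_trace_separated; exact: Zgen.
Qed.
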